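(* Let $k$ be an algebraically closed field of characteristic not equal to $2$, let $C_0\subset\mathbb{P}^2_k$ be an algebraic billiard curve of degree $d\ge2$ with desingularization $C\to C_0$, and let $s$, $r$ and $b=r\circ s$ be the secant, reflection and billiards correspondences on $C\times D$. Let $\omega$ be the rational $2$-form on $\mathbb{P}^2\times\mathbb{P}^2$ (coordinates $[X_0:X_1:X_2]$, $[Q_0:Q_1:Q_2]$) given on the affine chart with coordinates $x_0=X_0/X_2$, $x_1=X_1/X_2$, $q_0=Q_0/Q_2$, $q_1=Q_1/Q_2$ by $$\omega = dx_0\wedge dq_0+dx_1\wedge dq_1 .$$ Then the pullback $\omega|_{C\times D}$ of $\omega$ to $C\times D$ (via $C\to C_0\subset\mathbb{P}^2$ and $D\subset\mathbb{P}^2$) is invariant for $b$, for $s$, and for $r$. In particular $b$ possesses an invariant rational $2$-form.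
   Context: Correspondences. A dominant rational correspondence $f:Y\vdash Y$ on a (possibly reducible) surface $Y$ is given by an effective $2$-cycle $\Gamma_f$ in $Y\times Y$ such that each component of $\Gamma_f$ projects dominantly and generically finitely onto an irreducible component of $Y$ under each of the two projections $\pi_1,\pi_2$. A composite $g\circ f$ is formed by restricting to a dense open set $U$ of points $x$ with $f(x)$ finite and avoiding the points over which the first projection of $\Gamma_g$ has infinite fiber, taking the fiber product $\Gamma_f\times_Y\Gamma_g$ there, pushing it to $U\times Y$ as a cycle, and closing up. A rational differential form $\eta$ on $Y$ is $f$-invariant if $\pi_1^*\eta=\pi_2^*\eta$ on (every component of) $\Gamma_f$. Setup. Let $X=\mathbb{P}^2$ with coordinates $[X_0:X_1:X_2]$, $L_\infty=\{X_2=0\}$, and $Q=\mathbb{P}^2$ with coordinates $[Q_0:Q_1:Q_2]$; $D\subset Q$ is the conic $Q_0^2+Q_1^2=Q_2^2$. The slope of a line $\ell\ne L_\infty$ is $\ell\cap L_\infty=[a:b:0]$, regarded as $[a:b]\in\mathbb{P}^1$; the slopes $[1:\pm i]$ ($i^2=-1$) are called isotropic. An algebraic billiard curve is a plane curve $C_0\subset X$ (a sum of irreducible curves, possibly with multiplicity, possibly singular) of degree $d\ge2$ not containing any multiple line, any line of isotropic slope, or $L_\infty$. $C\to C_0$ is its desingularization: the disjoint union of the normalizations of the irreducible components, each counted with its multiplicity. The tangent slope map $t=[t_0:t_1]:C\to\mathbb{P}^1$ is the morphism sending a point over a nonsingular point of $C_{0}\cap\{X_2\neq0\}$ (reduced structure)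 to the slope of the tangent line there; the normal slope is $n(c)=[-t(c)_1:t(c)_0]$. Write points of $(C\times D)^2$ as $(c,q,c',q')$, where $c,c'$ have images $[X_0:X_1:X_2]$, $[X_0':X_1':X_2']$ in $X$, and $q=[Q_0:Q_1:Q_2]$, $q'=[Q_0':Q_1':Q_2']$. - $\Gamma_s$ is the $2$-cycle of $\{q=q',\ \det\begin{pmatrix} X_0 & X_0' & Q_0 \\ X_1 & X_1' & Q_1 \\ X_2 & X_2' & 0 \end{pmatrix}=0\}$ minus the diagonal, with any components that do not project dominantly (these are $(\ell\times q)^2$ for line components $\ell$ of slope $[Q_0:Q_1]$) discarded. - $\Gamma_r$ is the $2$-cycle of $\{c=c',\ \det\begin{pmatrix} Q_0 & Q_0' & n(c)_0 \\ Q_1 & Q_1' & n(c)_1 \\ Q_2 & Q_2' & 0 \end{pmatrix}=0\}$ minus the diagonal. It is part of the setup that $s$ and $r$ are dominant rational correspondences, so that $b=r\circ s$ is defined. *)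

(* Defs.v *)
From mathcomp Require Import all_boot all_order all_algebra.
From mathcomp Require Export mpoly.

Set Implicit Arguments.
Unset Strict Implicit.
Unset Printing Implicit Defensive.

Import GRing.Theory.
Local Open Scope ring_scope.

(******************************************************************************)
(* Conventions.                                                               *)
(*                                                                            *)
(* A plane curve is an effective divisor, i.e. a finite family F_i (i < m) of *)
(* irreducible forms in X_0, X_1, X_2; multiplicities are repetitions.  Its   *)
(* desingularization C is the disjoint union of the normalizations C_i of     *)
(* {F_i = 0}, so that Y = C x D has the m irreducible components C_i x D.     *)
(*                                                                            *)
(* An irreducible subvariety V of Y x Y is described by its function field    *)
(* K = k(V) and its generic point, which is a pair of K-points of Y.  All the *)
(* subvarieties in play project dominantly to both factors, so each of these  *)
(* K-points is a morphism Spec K -> C_i x D with dense image.  Such a         *)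
(* morphism lands in the locus where C_i -> {F_i = 0} is an isomorphism and   *)
(* where X_2 and Q_2 are invertible: it is determined by the index i and the  *)
(* values in K of the rational functions x_0, x_1, q_0, q_1.                  *)
(******************************************************************************)

Definition vec2 (T : Type) (a b : T) : 'I_2 -> T := tnth [tuple a; b].
Definition vec3 (T : Type) (a b c : T) : 'I_3 -> T := tnth [tuple a; b; c].
Definition vec4 (T : Type) (a b c d : T) : 'I_4 -> T :=
  tnth [tuple a; b; c; d].

(* The determinant of the 3 x 3 matrix with columns u, v, w.                  *)
Definition det3 (K : fieldType) (u v w : 'I_3 -> K) : K :=
  \det (\matrix_(i < 3, j < 3) vec3 u v w j i).

(******************************************************************************)
(* Plane curves                                                               *)
(******************************************************************************)

Definition form_degree (k : fieldType) (f : {mpoly k[3]}) : nat :=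
  (msize f).-1.

Record irreducible_form (k : fieldType) (f : {mpoly k[3]}) : Prop := {
  iform_homog : f \is (form_degree f).-homog;
  iform_deg : (0 < form_degree f)%N;
  iform_irr : forall g h : {mpoly k[3]}, f = g * h ->
    g \is a GRing.unit \/ h \is a GRing.unit
}.

(* The line a_0 X_0 + a_1 X_1 + a_2 X_2 = 0 meets X_2 = 0 at [a_1 : -a_0 : 0] *)
Definition slope (K : fieldType) (a : 'I_3 -> K) : 'I_2 -> K :=
  vec2 (a 1) (- a 0).

(* [s_0 : s_1] = [1 : i] for a square root i of -1 (both signs are covered).  *)
Definition isotropic (K : fieldType) (s : 'I_2 -> K) : Prop :=
  s 0 != 0 /\ exists i : K, i ^+ 2 = - 1 /\ s 1 = i * s 0.

Definition line_coefs (k : fieldType) (f : {mpoly k[3]}) : 'I_3 -> k :=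
  fun j => f@_U_(j).

Record billiard_curve (k : fieldType) (d m : nat) (F : 'I_m -> {mpoly k[3]}) :
    Prop := {
  bc_irreducible : forall i, irreducible_form (F i);
  bc_degree : (\sum_(i < m) form_degree (F i))%N = d;
  bc_no_multiple_line : forall i j, i != j -> form_degree (F i) = 1%N ->
    forall c : k, F j <> c *: F i;
  bc_no_isotropic_line : forall i, form_degree (F i) = 1%N ->
    ~ isotropic (slope (line_coefs (F i)));
  bc_no_infinity : forall i (c : k), F i <> c *: 'X_2
}.

(******************************************************************************)
(* Points of Y = C x D                                                        *)
(******************************************************************************)

Record point (m : nat) (K : Type) := Point {
  idx : 'I_m;
  px0 : K; px1 : K;
  pq0 : K; pq1 : K
}.

Definition map_point (m : nat) (K L : Type) (f : K -> L) (y : point m K) :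
    point m L :=
  Point (idx y) (f (px0 y)) (f (px1 y)) (f (pq0 y)) (f (pq1 y)).

Definition coords (m : nat) (K : Type) (y : point m K) : 'I_4 -> K :=
  vec4 (px0 y) (px1 y) (pq0 y) (pq1 y).

Definition hcoordX (m : nat) (K : fieldType) (y : point m K) : 'I_3 -> K :=
  vec3 (px0 y) (px1 y) 1.
Definition hcoordQ (m : nat) (K : fieldType) (y : point m K) : 'I_3 -> K :=
  vec3 (pq0 y) (pq1 y) 1.

Section Points.
Context (k : fieldType) (m : nat) (F : 'I_m -> {mpoly k[3]}).

Definition on_Y (K : fieldType) (emb : {rmorphism k -> K}) (y : point m K) :
    Prop :=
  mmap emb (hcoordX y) (F (idx y)) = 0 /\ pq0 y ^+ 2 + pq1 y ^+ 2 = 1.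

(* y : Spec K -> Y is a morphism to the component C_i x D with i = idx y, and *)
(* its image is Zariski dense there: a regular function of the affine chart   *)
(* that vanishes at y vanishes at all the k-points of that component.         *)
Definition dominates (K : fieldType) (emb : {rmorphism k -> K})
    (y : point m K) : Prop :=
  on_Y emb y /\
  forall G : {mpoly k[4]}, mmap emb (coords y) G = 0 ->
    forall a : point m k, idx a = idx y -> on_Y idfun a -> G.@[coords a] = 0.

(* The slope at x of the tangent line sum_j (dF_i/dX_j)(x) X_j = 0 to C_i,    *)
(* and the normal slope.                                                      *)
Definition tangent_slope (K : fieldType) (emb : {rmorphism k -> K})
    (y : point m K) : 'I_2 -> K :=
  slope (fun j => mmap emb (hcoordX y) (F (idx y))^`M(j)).
Definition normal_slope (K : fieldType) (emb : {rmorphism k -> K})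
    (y : point m K) : 'I_2 -> K :=
  let t := tangent_slope emb y in vec2 (- t 1) (t 0).

End Points.

(* z belongs to the subfield k(v_0, ..., v_(n-1)) of K.                       *)
Definition in_adjoin (k K : fieldType) (emb : {rmorphism k -> K}) (n : nat)
    (v : 'I_n -> K) (z : K) : Prop :=
  exists P R : {mpoly k[n]},
    mmap emb v R != 0 /\ z = mmap emb v P / mmap emb v R.

Definition algebraic_over (K : fieldType) (E : K -> Prop) (z : K) : Prop :=
  exists p : {poly K}, [/\ p != 0, forall i, E p`_i & root p z].

(******************************************************************************)
(* Correspondences                                                            *)
(******************************************************************************)

(* A prime 2-cycle of Y x Y each of whose two projections is dominant and     *)
(* generically finite onto a component of Y, through its generic point.       *)
Record prime_corr (k : fieldType) (m : nat) (F : 'I_m -> {mpoly k[3]}) :=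
    PrimeCorr {
  pfield : fieldType;
  pemb : {rmorphism k -> pfield};
  psrc : point m pfield;
  ptgt : point m pfield;
  psrc_dominates : dominates F pemb psrc;
  ptgt_dominates : dominates F pemb ptgt;
  psrc_finite : forall z, algebraic_over (in_adjoin pemb (coords psrc)) z;
  ptgt_finite : forall z, algebraic_over (in_adjoin pemb (coords ptgt)) z;
  pgenerated : forall z, in_adjoin pemb
    (fun i : 'I_(4 + 4) => match split i with
                           | inl j => coords psrc j
                           | inr j => coords ptgt j
                           end) z
}.

(* Only the set of components of the cycle is recorded: composition acts on   *)
(* it (push-forward of effective cycles creates no cancellation) and          *)
(* invariance of a form depends on nothing else.                              *)
Definition correspondence (k : fieldType) (m : nat) (F : 'I_m -> {mpoly k[3]}) :=
  prime_corr F -> Prop.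

Section Correspondences.
Context (k : fieldType) (m : nat) (F : 'I_m -> {mpoly k[3]}).
Implicit Type G : prime_corr F.

(* In secant and reflection the diagonal has multiplicity one in the cycle    *)
(* cut out by the equations, so removing it once removes that component.      *)
(* Both cycles have pure dimension 2.  Components that do not project         *)
(* dominantly are discarded by the type prime_corr; for reflection there are  *)
(* none, unless all the tangents of some C_i have the same isotropic slope,   *)
(* in which case the literal cycle is not a dominant correspondence.          *)

Definition secant : correspondence F := fun G =>
  let y := psrc G in let y' := ptgt G in
  [/\ pq0 y = pq0 y', pq1 y = pq1 y',
      det3 (hcoordX y) (hcoordX y') (vec3 (pq0 y) (pq1 y) 0) = 0
    & y <> y'].

Definition reflection : correspondence F := fun G =>
  let y := psrc G in let y' := ptgt G in
  let n := normal_slope F (pemb G) y in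
  [/\ idx y = idx y', px0 y = px0 y', px1 y = px1 y',
      det3 (hcoordQ y) (hcoordQ y') (vec3 (n 0) (n 1) 0) = 0
    & y <> y'].

(* Over the generic point of each component of Y, a point of the fiber        *)
(* product of f and g is a triple (y, y', z) over some extension M, where     *)
(* (y, y') and (y', z) are generic points of components A of f and B of g;    *)
(* the components of g o f are the closures of the images (y, z).             *)
Definition compose (g f : correspondence F) : correspondence F := fun G =>
  exists A B : prime_corr F, [/\ f A, g B &
  exists (M : fieldType) (emb : {rmorphism k -> M})
         (phi : {rmorphism pfield G -> M})
         (alpha : {rmorphism pfield A -> M})
         (beta : {rmorphism pfield B -> M}),
    [/\ phi \o pemb G =1 emb, alpha \o pemb A =1 emb & beta \o pemb B =1 emb] /\
    [/\ map_point phi (psrc G) = map_point alpha (psrc A),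
        map_point alpha (ptgt A) = map_point beta (psrc B)
      & map_point beta (ptgt B) = map_point phi (ptgt G)]].

Definition billiards : correspondence F := compose reflection secant.

End Correspondences.

(******************************************************************************)
(* Rational 2-forms                                                           *)
(******************************************************************************)

(* A list of triples (f, g, h) stands for the element sum f dg /\ dh of the   *)
(* exterior square of the module of Kaehler differentials of K over k.        *)
Definition kaehler2 (K : Type) := seq (K * K * K).

Record alternating_biderivation (k K : fieldType) (emb : {rmorphism k -> K})
    (M : lmodType K) (b : K -> K -> M) : Prop := {
  abd_addl : forall g g' h, b (g + g') h = b g h + b g' h;
  abd_addr : forall g h h', b g (h + h') = b g h + b g h';
  abd_mull : forall g g' h, b (g * g') h = g *: b g' h + g' *: b g h;
  abd_mulr : forall g h h', b g (h * h') = h *: b g h' + h' *: b g h;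
  abd_constl : forall (c : k) h, b (emb c) h = 0;
  abd_constr : forall (c : k) g, b g (emb c) = 0;
  abd_alt : forall g, b g g = 0
}.

(* Equality in the exterior square of Omega_(K/k), through its universal      *)
(* property: it represents the functor sending a K-module M to the            *)
(* alternating k-biderivations K x K -> M.                                    *)
Definition kaehler2_eq (k K : fieldType) (emb : {rmorphism k -> K})
    (s t : kaehler2 K) : Prop :=
  forall (M : lmodType K) (b : K -> K -> M), alternating_biderivation emb b ->
    \sum_(u <- s) u.1.1 *: b u.1.2 u.2 = \sum_(u <- t) u.1.1 *: b u.1.2 u.2.

(* A rational function in x_0, x_1, q_0, q_1, as numerator and denominator.   *)
(* Every rational function on C_i x D is the restriction of such a fraction   *)
(* whose denominator does not vanish identically there; as usual P / 0 = 0.   *)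
Definition ratfun (k : fieldType) := ({mpoly k[4]} * {mpoly k[4]})%type.

Definition ratfun_at (k K : fieldType) (emb : {rmorphism k -> K})
    (v : 'I_4 -> K) (f : ratfun k) : K :=
  mmap emb v f.1 / mmap emb v f.2.

(* A rational 2-form on P^2 x P^2, on the chart X_2, Q_2 <> 0.                *)
Definition form2 (k : fieldType) := kaehler2 (ratfun k).

(* A rational 2-form on Y: one on each component C_i x D, given by            *)
(* representatives of the elements of the function field.                     *)
Definition form2_Y (k : fieldType) (m : nat) := 'I_m -> form2 k.

Definition restrict_Y (k : fieldType) (m : nat) (eta : form2 k) : form2_Y k m :=
  fun=> eta.

Section Forms.
Context (k : fieldType) (m : nat) (F : 'I_m -> {mpoly k[3]}).

(* The pullback of eta along a dominant y : Spec K -> Y.                      *)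
Definition pullback (K : fieldType) (emb : {rmorphism k -> K}) (y : point m K)
    (eta : form2_Y k m) : kaehler2 K :=
  let e := ratfun_at emb (coords y) in
  [seq (e u.1.1, e u.1.2, e u.2) | u <- eta (idx y)].

Definition invariant_form (f : correspondence F) (eta : form2_Y k m) : Prop :=
  forall G : prime_corr F, f G ->
    kaehler2_eq (pemb G) (pullback (pemb G) (psrc G) eta)
                         (pullback (pemb G) (ptgt G) eta).

(* eta is not the zero form on any component of Y: it is nonzero in the       *)
(* function field K of C_i x D, with generic point y.                         *)
Definition nonzero_form (eta : form2_Y k m) : Prop :=
  forall (K : fieldType) (emb : {rmorphism k -> K}) (y : point m K),
    dominates F emb y -> (forall z, in_adjoin emb (coords y) z) ->
    ~ kaehler2_eq emb (pullback emb y eta) [::].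

End Forms.

(* omega = dx_0 /\ dq_0 + dx_1 /\ dq_1                                        *)
Definition omega (k : fieldType) : form2 k :=
  let x0 : ratfun k := ('X_(@Ordinal 4 0 isT), 1) in
  let x1 : ratfun k := ('X_(@Ordinal 4 1 isT), 1) in
  let q0 : ratfun k := ('X_(@Ordinal 4 2 isT), 1) in
  let q1 : ratfun k := ('X_(@Ordinal 4 3 isT), 1) in
  let one : ratfun k := (1, 1) in
  [:: (one, x0, q0); (one, x1, q1)].

(* Main.v *)
From HB Require Import structures.
Require Import Defs.
From mathcomp Require Import all_boot all_order all_algebra.
From mathcomp Require Import ring.
From Stdlib Require Classical_Prop.

Set Implicit Arguments.
Unset Strict Implicit.
Unset Printing Implicit Defensive.

Import GRing.Theory.
Local Open Scope ring_scope.

(* If (x, q) and (x', q) are related by the secant correspondence then        *)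
(* x - x' = l q, and sum_i d(l q_i) /\ dq_i = dl /\ sum_i q_i dq_i = 0 on the *)
(* conic.  If (x, q) and (x, q') are related by reflection then q - q' = l n  *)
(* for the gradient n of the equation of the curve, and                       *)
(* sum_i dx_i /\ d(l n_i) = 0 because sum_i n_i dx_i = 0 and dx_0 /\ dx_1 = 0 *)
(* on the curve.  That n does not vanish generically, in any characteristic,  *)
(* follows from a Nullstellensatz for irreducible plane curves: otherwise the *)
(* equation f would divide its partial derivatives, so these would be 0 and f *)
(* would be a constant or a p-th power.  The form is nonzero because the      *)
(* wedge product of the tangent derivations f_y d/dx_0 - f_x d/dx_1 and       *)
(* q_1 d/dq_0 - q_0 d/dq_1 takes on it the value n . q, which is not          *)
(* identically zero.                                                          *)

(** * Nullstellensatz for plane curves *)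

(** Equality of 2-forms is tested on an arbitrary alternating biderivation [b] of the function field
    of a component, so invariance under [s] and [r] becomes a computation with the coordinates of
    the two ends. For a chord it is [secant_biderivation], where differentiating the conic requires
    division by 2. For a reflection it is [normal_biderivation], which needs a nonzero gradient. A
    billiards path (c, q), (c', q), (c', q') is a chord followed by a reflection. Its middle point
    borrows its coordinates from the two ends, so both computations take place in the function field
    of the composite ([billiards_invariant]). Two geometric inputs remain. The first is that the
    normal n satisfies n . q != 0 at a generic point ([grad_not_tangent]). It rests on
    [has_smooth_point], hence on [plane_curve_nullstellensatz] and [irreducible_gradient]. These
    concern polynomials in two variables, and [affine_irreducible] carries irreducibility over from
    forms. The second is that [omega] is nonzero, which calls for actual derivations of the function
    field of C_i x D. By [product_nullstellensatz] a polynomial vanishing at the k-points of the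
    product also vanishes at its K-points. The tangent derivations of the two factors therefore
    respect all relations between the coordinates and extend by [extend_derivation]; their wedge
    takes the value n . q on [omega]. *)

Section Bivariate.
Context (k : fieldType) (K : comNzRingType) (emb : {rmorphism k -> K}).

Definition beval (x y : K) : {poly {poly k}} -> K :=
  horner_eval y \o map_poly (horner_eval x \o map_poly emb).

HB.instance Definition _ x y := GRing.RMorphism.on (beval x y).

Lemma bevalX x y : beval x y 'X = y.
Proof. by rewrite /beval /= map_polyX /horner_eval hornerX. Qed.

Lemma bevalC x y p : beval x y p%:P = (map_poly emb p).[x].
Proof. by rewrite /beval /= map_polyC /horner_eval /= hornerC. Qed.

End Bivariate.

Lemma beval_idfun (k : fieldType) (x y : k) p :
  beval idfun x y p = (map_poly (horner_eval x) p).[y].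
Proof.
rewrite /beval /=; congr (_.[_]); apply: eq_map_poly => q /=.
by rewrite map_poly_id.
Qed.

Definition irreducible_elt (R : unitRingType) (f : R) : Prop :=
  f \isn't a GRing.unit /\
  forall g h, f = g * h -> g \is a GRing.unit \/ h \is a GRing.unit.

Lemma XsubC_dvd_coef (k : fieldType) (al : k) (p : {poly {poly k}}) :
  map_poly (horner_eval al) p = 0 -> exists q, p = ('X - al%:P)%:P * q.
Proof.
move=> p0; exists (map_poly (fun c => c %/ ('X - al%:P)) p).
apply/polyP=> i; rewrite coefCM coef_map_id0 ?div0p // mulrC divpK //.
rewrite dvdp_XsubCl /root -[_.[_]]/(horner_eval al p`_i).
by rewrite -coef_map p0 coef0.
Qed.

Lemma XsubC_prime (k : fieldType) (al : k) (a f g : {poly {poly k}}) :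
    ('X - al%:P)%:P * a = f * g ->
  (exists2 f', f = ('X - al%:P)%:P * f' & a = f' * g) \/
  (exists2 g', g = ('X - al%:P)%:P * g' & a = f * g').
Proof.
move=> eq_fg; have nzX : ('X - al%:P)%:P != 0 :> {poly {poly k}}.
  by rewrite polyC_eq0 polyXsubC_eq0.
have /eqP : map_poly (horner_eval al) (f * g) = 0.
  rewrite -eq_fg rmorphM /= map_polyC /= /horner_eval hornerXsubC subrr polyC0.
  by rewrite mul0r.
rewrite rmorphM /= mulf_eq0 => /orP[] /eqP /XsubC_dvd_coef [h hE].
  by left; exists h => //; apply: (mulfI nzX); rewrite eq_fg hE mulrA.
by right; exists h => //; apply: (mulfI nzX); rewrite eq_fg hE mulrCA.
Qed.

(* Gauss' lemma, the ring k[x] being a product of prime factors X - al.       *)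
Lemma cancel_const (k : closedFieldType) (c : {poly k})
    (a f g : {poly {poly k}}) : c != 0 -> c%:P * a = f * g ->
  exists f' g' u v,
    [/\ u != 0, v != 0, f = u%:P * f', g = v%:P * g' & a = f' * g'].
Proof.
have [n] := ubnP (size c); elim: n c a f g => // n IHn c a f g.
rewrite ltnS => le_cn nz_c eq_fg.
have [/closed_rootP[al /factor_theorem[c1 c1E]]|] := boolP (size c != 1).
  have nz_c1 : c1 != 0 by apply: contraNneq nz_c => c10; rewrite c1E c10 mul0r.
  have lt_c1 : (size c1 < n)%N.
    by rewrite (leq_trans _ le_cn) // c1E size_Mmonic ?monicXsubC //
      size_XsubC addn2.
  have nzXa : 'X - al%:P != 0 by rewrite polyXsubC_eq0.
  have /XsubC_prime[] : ('X - al%:P)%:P * (c1%:P * a) = f * g.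
  - by rewrite -eq_fg c1E polyCM; ring.
  - case=> f1 f1E /(IHn _ _ _ _ lt_c1 nz_c1) [f' [g' [u [v [nzu nzv fE gE aE]]]]].
    exists f', g', (('X - al%:P) * u), v.
    split=> //; first by rewrite mulf_neq0.
    by rewrite f1E fE polyCM mulrA.
  case=> g1 g1E /(IHn _ _ _ _ lt_c1 nz_c1) [f' [g' [u [v [nzu nzv fE gE aE]]]]].
  exists f', g', u, (('X - al%:P) * v); split=> //; first by rewrite mulf_neq0.
  by rewrite g1E gE polyCM mulrA.
rewrite negbK => /size_poly1P[c0 nz_c0 cE].
have c0V : c0^-1%:P%:P * c%:P = 1 :> {poly {poly k}}.
  by rewrite cE -!polyCM mulVf.
(* Here [c] is a nonzero scalar, and its inverse is absorbed into [f]. *)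
exists (c0^-1%:P%:P * f), g, c0%:P, 1; split; rewrite ?oner_eq0 ?mul1r //.
- by rewrite polyC_eq0.
- by rewrite mulrA -!polyCM divff // mul1r.
by rewrite -mulrA -eq_fg mulrA c0V mul1r.
Qed.

Section PlaneCurve.
Context (k : closedFieldType) (f : {poly {poly k}}) (irr_f : irreducible_elt f).

Lemma irreducible_elt_neq0 : f != 0.
Proof.
case: irr_f => _ irr; apply/eqP=> f0.
by case: (irr 0 0); rewrite ?f0 ?mulr0 // unitr0.
Qed.

(** Gauss' lemma gives f = u f' with u in k[x] and f' dividing a. Since f has positive degree in y,
    f' is not a unit, so u is one. *)
Lemma irreducible_dvd_cancel (c : {poly k}) (a g : {poly {poly k}}) :
  (1 < size f)%N -> c != 0 -> c%:P * a = f * g -> exists h, a = f * h.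
Proof.
move=> szf nz_c /(cancel_const nz_c)[f' [g' [u [v [nzu nzv fE gE ->]]]]].
case: irr_f => _ /(_ _ _ fE)[Uu|Uf'].
  by exists (u%:P^-1 * g'); rewrite fE mulrACA divrr // mul1r.
have: (size f <= 1)%N; last by rewrite leqNgt szf.
move: Uf'; rewrite poly_unitE => /andP[/eqP sz1 _].
by rewrite fE size_Cmul // sz1.
Qed.

Lemma poly_vanishing_everywhere (p : {poly k}) : (forall x, root p x) -> p = 0.
Proof.
move=> p0; apply/eqP; apply: contraT => /closed_nonrootP[x].
by rewrite p0.
Qed.

(** If f has positive degree in y, the ideal (f, a) contains no nonzero element of k[x]. The
    resultant in y then vanishes, so f and a share a factor of positive degree in y, which by
    irreducibility is f up to elements of k[x]. *)
Lemma plane_curve_nullstellensatz (a : {poly {poly k}}) :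
    (forall x y, beval idfun x y f = 0 -> beval idfun x y a = 0) ->
  exists g, a = f * g.
Proof.
move=> fa; have [szf|szf] := leqP (size f) 1.
  (* A curve without y in its equation is a vertical line x = al. *)
  have [p fE] : exists p, f = p%:P by exists f`_0; apply: size1_polyC.
  case: irr_f => nUf irr.
  have /closed_rootP[al /factor_theorem[p1 p1E]] : size p != 1.
    apply: contraNN nUf => /size_poly1P[c nz_c cE].
    by rewrite fE cE !rmorph_unit // unitfE.
  have fE' : f = p1%:P * ('X - al%:P)%:P by rewrite fE p1E polyCM.
  have /XsubC_dvd_coef[g ->] : map_poly (horner_eval al) a = 0.
    apply: poly_vanishing_everywhere => y; apply/eqP; rewrite -beval_idfun fa //.
    rewrite beval_idfun fE' rmorphM /= [X in _ * X]map_polyC /= /horner_eval.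
    by rewrite hornerXsubC subrr mulr0 horner0.
  have [Up|] := irr _ _ fE'.
    by exists (p1%:P^-1 * g); rewrite fE' mulrACA divrr // mul1r.
  by rewrite poly_unitE coefC /= poly_unitE size_XsubC andbF.
(* Over every x where the leading coefficient of f does not vanish there is a point of the curve,
   and c vanishes there. *)
have bez (c : {poly k}) (u v : {poly {poly k}}) :
    c%:P = u * f + v * a -> c = 0.
  move=> cE; have: c * lead_coef f = 0; last first.
    by move/eqP; rewrite mulf_eq0 lead_coef_eq0 (negPf irreducible_elt_neq0)
      orbF => /eqP.
  apply: poly_vanishing_everywhere => x; rewrite rootM.
  apply/orP.
  have [rl|nz_l] := boolP (root (lead_coef f) x); [by right | left].
  have : size (map_poly (horner_eval x) f) != 1.
    by rewrite size_map_poly_id0 -?lead_coefE // gtn_eqF.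
  move=> /closed_rootP[y /eqP]; rewrite -beval_idfun => fxy.
  move: (congr1 (beval idfun x y) cE).
  rewrite rmorphD !rmorphM /= fxy fa // !mulr0 addr0 bevalC map_poly_id //.
  by move/eqP.
have [sza|sza] := leqP (size a) 1.
  exists 0; rewrite mulr0 (size1_polyC sza) (bez a`_0 0 1) //.
  by rewrite mul0r add0r mul1r -size1_polyC.
have /eqP : resultant f a = 0.
  have [[u v] _ /= cE] := resultant_in_ideal szf sza.
  exact: bez cE.
rewrite resultant_eq0 => szh.
have /Pdiv.Idomain.dvdpP[[c1 g1] /= nz_c1] := dvdp_gcdl f a.
have /Pdiv.Idomain.dvdpP[[c2 g2] /= nz_c2] := dvdp_gcdr f a.
move: (gcdp f a) szh => h szh eq2; rewrite -mul_polyC mulrC => eq1.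
have := eq1; rewrite mulrC => /(cancel_const nz_c1).
move=> [g' [h' [u [v [nzu nzv gE hE fE]]]]].
case: irr_f => _ /(_ _ _ fE) [Ug|]; last first.
  rewrite poly_unitE => /andP[/eqP sz1 _].
  by move: szh; rewrite hE size_Cmul // sz1.
apply: (irreducible_dvd_cancel (c := c2) (g := g'^-1 * v%:P * g2)) => //.
rewrite mul_polyC eq2 hE fE -[LHS]mul1r -(divrr Ug); ring.
Qed.

End PlaneCurve.

(** Only exponents divisible by p survive, and the Frobenius map is additive. *)
Lemma deriv_eq0_pth_power (R : idomainType) (p : nat) (g : {poly R}) :
    p \in [pchar R] -> g^`() = 0 -> (forall i, exists r, g`_i = r ^+ p) ->
  exists w, g = w ^+ p.
Proof.
move=> chp g'0 rts; have p_gt0 := prime_gt0 (pcharf_prime chp).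
have chpX : p \in [pchar {poly R}] by rewrite (rmorph_pchar (polyC)).
rewrite -[g]coefK poly_def.
elim/big_ind: _ => [|_ _ [u ->] [v ->]|i _].
- by exists 0; rewrite expr0n gtn_eqF.
- by exists (u + v); rewrite exprDn_pchar // pnatE ?(pcharf_prime chp).
have [r gi] := rts i.
have [->|nz_gi] := eqVneq g`_i 0.
  by exists 0; rewrite scale0r expr0n gtn_eqF.
suff /dvdnP[j jE] : (p %| i)%N.
  by exists (r *: 'X^j); rewrite exprZn -exprM -jE gi.
case: (nat_of_ord i) nz_gi => [|j] nz_g; first exact: dvdn0.
move/polyP/(_ j): g'0; rewrite coef_deriv coef0 -mulr_natr => /eqP.
by rewrite mulf_eq0 (negPf nz_g) -(dvdn_pcharf chp).
Qed.

(** * Smooth points of irreducible plane curves *)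

Section Gradient.
Context (k : closedFieldType).
Implicit Types f : {poly {poly k}}.

Lemma closed_pth_root (n : nat) (c : k) : (0 < n)%N -> exists r, c = r ^+ n.
Proof.
move=> n_gt0; have : size ('X^n - c%:P) != 1 by rewrite size_XnsubC // eqSS gtn_eqF.
case/closed_rootP=> r; rewrite /root hornerD hornerN hornerXn hornerC.
by rewrite subr_eq0 => /eqP; exists r.
Qed.

Lemma irreducible_gradient f :
  irreducible_elt f -> ~ (map_poly deriv f = 0 /\ f^`() = 0).
Proof.
move=> irr_f [fx0 fy0]; have nz_f := irreducible_elt_neq0 irr_f.
have coef_f i : (f`_i)^`() = 0 by rewrite -coef_map fx0 coef0.
(* In characteristic 0 a vanishing gradient would make f a constant, hence a unit. So the degree of
   f in y, or else in x, is positive and zero in k. *)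
have [p chp] : exists p, p \in [pchar k].
  have szf : (size f <= 1)%N \/ exists p, p \in [pchar k].
    case szE: (size f) => [|[|n]]; [by left|by left|right].
    apply: (@natf0_pchar k n.+1) => //.
    move/polyP/(_ n): fy0.
    rewrite coef_deriv coef0 -[f`_n.+1 *+ _]mulr_natr => /eqP.
    move: nz_f; rewrite -lead_coef_eq0 lead_coefE szE => nz_l.
    rewrite mulf_eq0 => /orP[l0|]; first by case/negP: nz_l.
    by rewrite -polyC_natr polyC_eq0.
  case: szf => // szf.
  have fE := size1_polyC szf; set c := f`_0 in fE.
  have nz_c : c != 0 by move: nz_f; rewrite fE polyC_eq0.
  case szE: (size c) => [|[|n]].
  - by move/eqP: szE nz_c; rewrite size_poly_eq0 => ->.
  - case: irr_f => /negP[]; rewrite fE.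
    have /size_poly1P[a nz_a ->] : size c == 1 by rewrite szE.
    by rewrite !rmorph_unit // unitfE.
  apply: (@natf0_pchar k n.+1) => //.
  move/polyP/(_ n): (coef_f 0%N).
  rewrite coef_deriv coef0 -[c`_n.+1 *+ _]mulr_natr => /eqP.
  move: nz_c; rewrite -lead_coef_eq0 lead_coefE szE => nz_l.
  by rewrite mulf_eq0 => /orP[l0|//]; case/negP: nz_l.
have p_gt1 := prime_gt1 (pcharf_prime chp).
(* The p-th root is taken in y, then in x for each coefficient, then in the algebraically closed
   field. *)
have [w wE] : exists w, f = w ^+ p.
  apply: deriv_eq0_pth_power; rewrite ?(rmorph_pchar polyC) // => i.
  apply: deriv_eq0_pth_power => // j; apply: closed_pth_root; exact: ltnW.
case: irr_f => nUf irr; case/negP: nUf; rewrite wE unitrX_pos ?(ltnW p_gt1) //.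
move: wE; rewrite -(subnKC p_gt1) addSn exprS => /irr[] //.
by rewrite unitrX_pos.
Qed.

(** Otherwise f divides both partial derivatives by the Nullstellensatz, and degrees force these to
    be 0. *)
Lemma has_smooth_point f : irreducible_elt f ->
  ~ (forall x y, beval idfun x y f = 0 ->
       beval idfun x y (map_poly deriv f) = 0 /\ beval idfun x y f^`() = 0).
Proof.
move=> irr_f sing; apply: (irreducible_gradient irr_f).
have nz_f := irreducible_elt_neq0 irr_f.
split; last first.
  have [x y /sing[]//|g gE] := plane_curve_nullstellensatz irr_f (a := f^`()).
  apply/eqP; apply: contraT => nz_f'; have := lt_size_deriv nz_f.
  rewrite gE ltnNge size_mul ?leq_addr //; last first.
    by apply: contraNneq nz_f' => g0; rewrite gE g0 mulr0.
  have nz_g : g != 0 by apply: contraNneq nz_f' => g0; rewrite gE g0 mulr0.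
  by rewrite -subn1 -addnBA ?leq_addr // size_poly_gt0.
have [x y /sing[]//|g gE] := plane_curve_nullstellensatz irr_f (a := map_poly deriv f).
rewrite gE; have [->|nz_g] := eqVneq g 0; first by rewrite mulr0.
(* Differentiation in x need not lower the degree in y. It only shows that the quotient [g] lies in
   k[x]; comparing leading coefficients in y then contradicts the drop of the degree in x. *)
have szg : size g = 1%N.
  apply/eqP; rewrite eqn_leq size_poly_gt0 nz_g andbT.
  have : (size (f * g)%R <= size f)%N.
    rewrite -gE; apply/leq_sizeP=> j /leq_sizeP le_f.
    by rewrite coef_map /= le_f // deriv0.
  rewrite size_mul // -subn1 leq_subLR addnC.
  by rewrite leq_add2r.
have /size_poly1P[c nz_c cE] : size g == 1%N by rewrite szg.
have := lt_size_deriv (p := lead_coef f); rewrite lead_coef_eq0 => /(_ nz_f).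
move/polyP/(_ (size f).-1): gE; rewrite cE coef_map mulrC coefCM -!lead_coefE => ->.
rewrite size_mul ?lead_coef_eq0 // ltnNge -subn1 -addnBAC ?leq_addl //.
by rewrite size_poly_gt0.
Qed.

End Gradient.

(** * Homogeneous forms and their affine equations *)

Lemma eq_mmap (n : nat) (R : nzRingType) (S : nzRingType) (f f' : R -> S)
    (h h' : 'I_n -> S) (p : {mpoly R[n]}) :
  f =1 f' -> h =1 h' -> mmap f h p = mmap f' h' p.
Proof.
by move=> ff hh; apply: eq_bigr => m _; rewrite ff (mmap1_eq _ hh).
Qed.

Lemma eq_mpoly_rmorphism (n : nat) (R S : nzRingType)
    (phi psi : {rmorphism {mpoly R[n]} -> S}) :
    (forall c, phi c%:MP = psi c%:MP) -> (forall i, phi 'X_i = psi 'X_i) ->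
  phi =1 psi.
Proof.
move=> eqC eqX p; rewrite [p]mpolyE !rmorph_sum; apply: eq_bigr => m _.
rewrite -mul_mpolyC !rmorphM eqC mpolyXE_id !rmorph_prod; congr (_ * _).
by apply: eq_bigr => i _; rewrite !rmorphXn eqX.
Qed.

Lemma mderiv_var (n : nat) (R : nzRingType) (i j : 'I_n) :
  'X_i^`M(j) = (i == j)%:R :> {mpoly R[n]}.
Proof.
rewrite mderivX mnm1E; case: eqP => [->|_]; last by rewrite scale0r.
suff -> : (U_(j) - U_(j) = 0)%MM by rewrite mpolyX0 scale1r.
by apply/mnmP=> l; rewrite mnmBE mnm0E subnn.
Qed.

(** Both sides are derivations in p that agree on constants and variables. Values in a module let
    the rule serve the partial derivatives after a substitution as well as one slot of a
    biderivation. *)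
Lemma mmap_chain_rule (n : nat) (R S : comNzRingType) (M : lmodType S)
    (f : {rmorphism R -> S}) (h : 'I_n -> S) (D : S -> M) :
    (forall u v, D (u + v) = D u + D v) ->
    (forall u v, D (u * v) = u *: D v + v *: D u) ->
    (forall c, D (f c) = 0) ->
  forall p : {mpoly R[n]},
    D (mmap f h p) = \sum_i mmap f h p^`M(i) *: D (h i).
Proof.
move=> DD DM DC p; pose P p := D (mmap f h p) = \sum_i mmap f h p^`M(i) *: D (h i).
have PC c : P c%:MP.
  rewrite /P mmapC DC big1 // => i _.
  by rewrite mderivC mmap0 scale0r.
have PD q r : P q -> P r -> P (q + r).
  rewrite /P rmorphD DD => -> ->; rewrite -big_split /=; apply: eq_bigr => i _.
  by rewrite mderivD rmorphD scalerDl.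
have PM q r : P q -> P r -> P (q * r).
  rewrite /P rmorphM DM => -> ->; rewrite !scaler_sumr -big_split /=.
  apply: eq_bigr => i _; rewrite mderivM rmorphD !rmorphM /= scalerDl !scalerA.
  by rewrite addrC [mmap f h r * _]mulrC.
have PX i : P 'X_i.
  rewrite /P mmapX mmap1U (bigD1 i) //= big1 => [|j /negPf ne_ji].
    by rewrite addr0 mderiv_var eqxx rmorph1 scale1r.
  by rewrite mderiv_var eq_sym ne_ji mmap0 scale0r.
rewrite -/(P p) [p]mpolyE; apply: (big_ind P) => //; first exact: (PC 0).
move=> m _; rewrite -mul_mpolyC; apply: (PM) => //.
rewrite mpolyXE_id; apply: (big_ind P) => //; first exact: (PC 1).
by move=> i _; elim: (m i) => [|j IHj]; [exact: (PC 1) | rewrite exprS; apply: PM].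
Qed.

Lemma deriv_natr (R : nzRingType) (n : nat) : n%:R^`() = 0 :> {poly R}.
Proof. by rewrite -polyC_natr derivC. Qed.

Lemma deriv1 (R : nzRingType) : 1^`() = 0 :> {poly R}.
Proof. exact: (deriv_natr R 1). Qed.

(* In {poly {poly k}} the inner variable is x_0 and the outer one x_1.        *)
Definition polyCC (k : nzRingType) : k -> {poly {poly k}} := polyC \o polyC.
HB.instance Definition _ (k : nzRingType) :=
  GRing.RMorphism.on (@polyCC k).

Section BivariateSubstitution.
Context (k : fieldType) (n : nat) (h : 'I_n -> {poly {poly k}}).
Implicit Types (p : {mpoly k[n]}) (f g : {poly {poly k}}).

Lemma beval_mmap (K : comNzRingType) (emb : {rmorphism k -> K}) (x y : K) p :
  beval emb x y (mmap (@polyCC k) h p) = mmap emb (beval emb x y \o h) p.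
Proof.
apply: (eq_mpoly_rmorphism (phi := beval emb x y \o mmap (@polyCC k) h)).
  by move=> c /=; rewrite !mmapC bevalC map_polyC hornerC.
by move=> i /=; rewrite !mmapX !mmap1U.
Qed.

Lemma map_poly_derivM f g : map_poly deriv (f * g) =
  map_poly deriv f * g + f * map_poly deriv g.
Proof.
apply/polyP=> i; rewrite coefD !coefM coef_map coefM raddf_sum /=.
by rewrite -big_split; apply: eq_bigr => j _; rewrite /= !coef_map derivM.
Qed.

Lemma deriv_mmap p : (mmap (@polyCC k) h p)^`() =
  \sum_i mmap (@polyCC k) h p^`M(i) * (h i)^`().
Proof.
apply: (@mmap_chain_rule _ _ _ {poly {poly k}}^o _ _ deriv) => [||c].
- exact: derivD.
- by move=> u v; rewrite derivM addrC; congr (_ + _); rewrite mulrC.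
- by rewrite derivC.
Qed.

Lemma map_deriv_mmap p : map_poly deriv (mmap (@polyCC k) h p) =
  \sum_i mmap (@polyCC k) h p^`M(i) * map_poly deriv (h i).
Proof.
apply: (@mmap_chain_rule _ _ _ {poly {poly k}}^o _ _ (map_poly deriv)) => [||c].
- exact: raddfD.
- by move=> u v; rewrite map_poly_derivM addrC; congr (_ + _); rewrite mulrC.
- by rewrite map_polyC /= derivC.
Qed.

End BivariateSubstitution.

Lemma map_deriv1 (k : fieldType) : map_poly deriv 1 = 0 :> {poly {poly k}}.
Proof. by apply/polyP=> i; rewrite coef_map coef1 coef0 /= deriv_natr. Qed.

Lemma map_derivX (k : fieldType) : map_poly deriv 'X = 0 :> {poly {poly k}}.
Proof. by apply/polyP=> i; rewrite coef_map coefX coef0 /= deriv_natr. Qed.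

Section Affine.
Context (k : fieldType).
Implicit Types (F : {mpoly k[3]}) (g : {poly {poly k}}).

Definition affine : {mpoly k[3]} -> {poly {poly k}} :=
  mmap (@polyCC k) (vec3 'X%:P 'X 1).
HB.instance Definition _ := GRing.RMorphism.on affine.

Lemma affineC c : affine c%:MP = c%:P%:P.
Proof. by rewrite /affine mmapC. Qed.

Lemma affineX i : affine 'X_i = vec3 'X%:P 'X 1 i.
Proof. by rewrite /affine mmapX mmap1U. Qed.

Lemma beval_affine (K : comNzRingType) (emb : {rmorphism k -> K}) (x y : K) F :
  beval emb x y (affine F) = mmap emb (vec3 x y 1) F.
Proof.
rewrite beval_mmap; apply: eq_mmap => // i /=.
case: i => [[|[|[|//]]] lti]; rewrite /vec3 !(tnth_nth 0) /=.
- by rewrite bevalC map_polyX hornerX.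
- by rewrite bevalX.
- by rewrite rmorph1.
Qed.

Lemma affine_mpoly g : affine (beval (@mpolyC 3 k) 'X_0 'X_1 g) = g.
Proof.
elim/poly_ind: g => [|g c IHg]; first by rewrite !rmorph0.
rewrite !(rmorphD, rmorphM) /= IHg bevalX bevalC affineX.
congr (_ * _ + _); elim/poly_ind: c => [|p a IHp].
  by rewrite rmorph0 horner0 rmorph0.
rewrite rmorphD rmorphM /= map_polyX map_polyC hornerMXaddC.
rewrite rmorphD rmorphM /= IHp affineX.
by rewrite affineC polyCD polyCM.
Qed.

Lemma affine_deriv1 F : (affine F)^`() = affine F^`M(1).
Proof.
rewrite deriv_mmap !big_ord_recl big_ord0 /= derivC derivX deriv1.
rewrite !mulr0 !addr0 add0r mulr1.
by congr (mmap _ _ (_^`M(_))); apply: val_inj.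
Qed.

Lemma affine_deriv0 F : map_poly deriv (affine F) = affine F^`M(0).
Proof.
rewrite map_deriv_mmap !big_ord_recl big_ord0 /= map_derivX map_polyC /= derivX.
rewrite map_deriv1 !mulr0 !addr0 mulr1.
by congr (mmap _ _ (_^`M(_))); apply: val_inj.
Qed.

(** Homogeneous parts of degree above n are dropped, so this is the usual homogenization only when p
    has degree at most n. *)
Definition homogenize (n : nat) (p : {mpoly k[3]}) : {mpoly k[3]} :=
  \sum_(d < n.+1) pihomog mdeg d p * 'X_ord_max ^+ (n - d).

Lemma homogenize_homog n p : homogenize n p \is n.-homog.
Proof.
apply: rpred_sum => d _.
suff: pihomog mdeg d p * 'X_ord_max ^+ (n - d) \is (d + 1 * (n - d)).-homog.
  by rewrite mul1n subnKC // -ltnS.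
by apply: dhomogM; [exact: pihomogP | rewrite dhomogMn ?dhomogX /= ?mdeg1].
Qed.

Lemma affine_homogenize n p :
  (msize p <= n.+1)%N -> affine (homogenize n p) = affine p.
Proof.
move=> le_pn; rewrite [in RHS](pihomog_partitionE le_pn) !rmorph_sum.
apply: eq_bigr => d _; rewrite rmorphM rmorphXn /= affineX.
by rewrite expr1n mulr1.
Qed.

Lemma homogenize_affine n F : F \is n.-homog ->
  let p := beval (@mpolyC 3 k) 'X_0 'X_1 (affine F) in
  (msize p <= n.+1)%N /\ homogenize n p = F.
Proof.
move=> homF p; pose m' (m : 'X_{1..3}) : 'X_{1..3} :=
  (U_(0%R) *+ m 0%R + U_(1%R) *+ m 1%R)%MM.
have pE : p = \sum_(m <- msupp F) F@_m *: 'X_[m' m].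
  rewrite /p beval_affine; apply: eq_bigr => m _.
  rewrite mul_mpolyC; congr (_ *: _).
  rewrite /mmap1 !big_ord_recl big_ord0 expr1n !mulr1 mpolyXD !mpolyXn.
  by congr ('X_[_ *+ m _] * 'X_[_ *+ m _]); apply: val_inj.
have degm m : m \in msupp F -> (mdeg (m' m) + m ord_max)%N = n.
  move/(dhomog_mf homF) => <- /=.
  rewrite /m' mdegD !mdegMn !mdeg1 !mul1n mdegE !big_ord_recl big_ord0 addn0.
  by rewrite addnA; congr (m _ + m _ + m _)%N; apply: val_inj.
split.
  rewrite pE; apply: (leq_trans (msize_sum _ _ _)).
  apply/bigmax_leqP_seq => m /degm dm _; apply: leq_trans (msizeZ_le _ _) _.
  by rewrite msizeX ltnS -dm leq_addr.
rewrite pE [RHS]mpolyE /homogenize.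
under eq_bigr do rewrite raddf_sum /= mulr_suml.
rewrite exchange_big /=; apply: eq_big_seq => m /degm dm.
have ltd : (mdeg (m' m) < n.+1)%N by rewrite ltnS -dm leq_addr.
rewrite (bigD1 (Ordinal ltd)) //= big1 => [|d ne_d].
  rewrite linearZ /= pihomogX eqxx addr0 -scalerAl; congr (_ *: _).
  rewrite -{1}dm addKn mpolyXn -mpolyXD; congr 'X_[_]; apply/mnmP=> i.
  rewrite !mnmDE !mulmnE !mnm1E.
  case: i => [[|[|[|//]]] lti] /=; rewrite ?mul0n ?mul1n ?addn0 ?add0n;
    congr (m _); exact: val_inj.
rewrite linearZ /= pihomogX ifN ?scaler0 ?mul0r //.
by apply: contraNneq ne_d => dE; apply/eqP/val_inj.
Qed.

(** A factorization of the affine equation homogenizes to one of F. The non-unit condition excludes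
    the line at infinity, whose affine equation is a constant. *)
Lemma affine_irreducible F : irreducible_form F ->
  affine F \isn't a GRing.unit -> irreducible_elt (affine F).
Proof.
move=> [homF degF irrF] nUF; split=> // g h gh.
set n := form_degree F in homF; pose iota := beval (@mpolyC 3 k) 'X_0 'X_1.
have [szF FE] := homogenize_affine homF.
have nz_aF : affine F != 0.
  apply: contraTneq degF => aF0; rewrite -FE aF0 rmorph0 /form_degree.
  rewrite /homogenize big1 ?msize0 // => d _.
  by rewrite pihomog0 mul0r.
have [nz_g nz_h] : g != 0 /\ h != 0 by apply/andP; rewrite -negb_or -mulf_eq0 -gh.
have nzi p : p != 0 -> iota p != 0.
  by apply: contraNneq => ip0; rewrite -[p]affine_mpoly -/iota ip0 rmorph0.
pose a := (msize (iota g)).-1; pose b := (msize (iota h)).-1.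
have sa : msize (iota g) = a.+1 by rewrite mpolySpred ?nzi.
have sb : msize (iota h) = b.+1 by rewrite mpolySpred ?nzi.
have le_ab : (a + b <= n)%N.
  move: szF; rewrite -/iota gh [iota _]rmorphM msizeM ?nzi // sa sb.
  by rewrite addSn addnS.
(* The power of X_2 pads the product to degree n exactly, and a form of degree n is determined by
   its affine equation. *)
pose P := homogenize a (iota g) * 'X_ord_max ^+ (n - (a + b)).
have aP : affine P = g.
  rewrite rmorphM rmorphXn /= affineX expr1n mulr1.
  by rewrite affine_homogenize ?sa // affine_mpoly.
pose Q := homogenize b (iota h).
have aQ : affine Q = h by rewrite affine_homogenize ?sb // affine_mpoly.
have homPQ : P * Q \is n.-homog.
  suff: P * Q \is (a + 1 * (n - (a + b)) + b).-homog.
    by rewrite mul1n addnAC subnKC.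
  apply: dhomogM (homogenize_homog _ _); apply: dhomogM (homogenize_homog _ _) _.
  by rewrite dhomogMn ?dhomogX /= ?mdeg1.
have [_] := homogenize_affine homPQ.
rewrite rmorphM /= aP aQ -gh FE => /irrF[UP|UQ]; [left|right].
  by rewrite -aP rmorph_unit.
by rewrite -aQ rmorph_unit.
Qed.

End Affine.

(** * The product of a plane curve and the conic *)

(* A relation between values over K reduces, by eliminating one coefficient   *)
(* u.2 at a time, to the polynomials u.1 that vanish at all the points P.     *)
Lemma extend_scalars (k K : fieldType) (emb : {rmorphism k -> K})
    (A : comNzRingType) (sc : k -> A) (I : Type)
    (ev : I -> {rmorphism A -> k}) (phi : {rmorphism A -> K}) :
    (forall P c, ev P (sc c) = c) -> (forall c, phi (sc c) = emb c) ->
    (forall a, (forall P, ev P a = 0) -> phi a = 0) ->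
  forall s : seq (A * K),
    (forall P, \sum_(u <- s) emb (ev P u.1) * u.2 = 0) ->
  \sum_(u <- s) phi u.1 * u.2 = 0.
Proof.
move=> evC phiC null s; have [n] := ubnP (size s).
elim: n s => // n IHn s; rewrite ltnS => le_sn ev0.
have [[P [u us nz_u]]|triv] :=
    Classical_Prop.classic (exists P, exists2 u, u \in s & ev P u.1 != 0);
  last first.
  rewrite big_seq big1 // => u us; rewrite null ?mul0r // => P.
  by apply/eqP; apply: contraT => nz; case: triv; exists P, u.
have perm_s := perm_to_rem us; set s' := rem u s in perm_s.
pose c (w : A * K) := ev P w.1 / ev P u.1.
have eq_u : \sum_(w <- s') emb (c w) * w.2 = - u.2.
  have nz_eu : emb (ev P u.1) != 0 by rewrite fmorph_eq0.
  apply: (mulfI nz_eu); rewrite mulrN; apply/eqP; rewrite -addr_eq0 addrC.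
  have := ev0 P; rewrite (perm_big _ perm_s) big_cons /= => {2}<-.
  apply/eqP; congr (_ + _); rewrite mulr_sumr; apply: eq_bigr => w _.
  by rewrite mulrA -rmorphM [ev P u.1 * _]mulrC divfK.
(* The relation at P expresses [u.2] through the other coefficients; substituting it leaves a
   shorter relation with the same values. *)
pose t := [seq (w.1 - sc (c w) * u.1, w.2) | w <- s'].
have eq_t (psi : {rmorphism A -> K}) : (forall a, psi (sc a) = emb a) ->
    \sum_(w <- t) psi w.1 * w.2 = \sum_(w <- s) psi w.1 * w.2.
  move=> psiC; rewrite (perm_big _ perm_s) big_cons big_map /=.
  under eq_bigr => w _.
    rewrite rmorphB rmorphM /= psiC mulrBl [emb _ * _]mulrC -mulrA; over.
  rewrite sumrB -mulr_sumr eq_u; ring.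
rewrite -eq_t //; apply: IHn => [|Q].
  by rewrite size_map size_rem // (leq_trans _ le_sn) // prednK //; case: (s) us.
by rewrite (eq_t (emb \o ev Q)) => [|a /=]; [exact: ev0 | rewrite evC].
Qed.

(** The conclusion of the Nullstellensatz as a property, shared by the irreducible curve and the
    conic. *)
Definition defines_radical (k : fieldType) (c : {poly {poly k}}) : Prop :=
  forall a : {poly {poly k}},
    (forall x y, beval idfun x y c = 0 -> beval idfun x y a = 0) ->
  exists g, a = c * g.

(** Writing a = c g, the gradient of a on the curve c = 0 is g times that of c. Hence c_y d/dx - c_x
    d/dy preserves the ideal of the curve. *)
Lemma tangent_derivative (k : fieldType) (c a : {poly {poly k}}) (x y : k) :
    defines_radical c ->
    (forall x y, beval idfun x y c = 0 -> beval idfun x y a = 0) ->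
    beval idfun x y c = 0 ->
  beval idfun x y c^`() * beval idfun x y (map_poly deriv a) =
  beval idfun x y (map_poly deriv c) * beval idfun x y a^`().
Proof.
move=> rad_c /rad_c[g ->] cxy; rewrite map_poly_derivM derivM.
by rewrite !rmorphD !rmorphM /= cxy !mul0r !addr0; ring.
Qed.

(** * The vanishing ideal of the conic *)

Section Conic.
Context (k : closedFieldType) (hk : 2%N \notin [pchar k]).

Definition conic : {poly {poly k}} := 'X^2 + ('X^2 - 1)%:P.

Lemma beval_conic (K : comNzRingType) (emb : {rmorphism k -> K}) x y :
  beval emb x y conic = x ^+ 2 + y ^+ 2 - 1.
Proof.
rewrite rmorphD rmorphXn /= bevalX bevalC rmorphB rmorphXn /= map_polyX rmorph1.
by rewrite hornerD hornerN hornerXn hornerC; ring.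
Qed.

Lemma beval_conic_deriv0 (x y : k) :
  beval idfun x y (map_poly deriv conic) = 2 * x.
Proof.
rewrite raddfD /= expr2 map_poly_derivM map_derivX mulr0 mul0r !add0r.
rewrite map_polyC bevalC map_poly_id //= derivB derivXn -polyC1 derivC subr0.
by rewrite hornerMn hornerX mulr_natl.
Qed.

Lemma beval_conic_deriv1 (x y : k) : beval idfun x y conic^`() = 2 * y.
Proof.
by rewrite derivD derivXn derivC addr0 rmorphMn /= bevalX mulr_natl.
Qed.

Lemma two_neq0 : 2 != 0 :> k.
Proof. by apply: contraNneq hk => k2; rewrite inE /= k2. Qed.

(** Division by the conic, monic in y, leaves r_1(x) y + r_0(x). Both points (x, y) and (x, -y) lie
    on the conic, so r_0 = 0 as 2 is invertible, and then r_1 (x^2 - 1) = 0. *)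
Lemma conic_radical : defines_radical conic.
Proof.
move=> a van_a.
have mon_c : conic \is monic.
  by rewrite monicE lead_coefDl ?lead_coefXn // size_polyXn size_polyC; case: eqP.
have sz_c : size conic = 3%N.
  by rewrite size_polyDl ?size_polyXn // size_polyC; case: eqP.
pose r := Pdiv.Ring.rmodp a conic.
have aE := Pdiv.RingMonic.rdivp_eq mon_c a.
exists (Pdiv.Ring.rdivp a conic); rewrite {1}aE mulrC -/r.
suff -> : r = 0 by rewrite addr0.
have rE : r = (r`_1)%:P * 'X + (r`_0)%:P.
  apply/polyP=> i; rewrite coefD coefCM coefX coefC.
  case: i => [|[|i]]; rewrite ?mulr0 ?add0r ?mulr1 ?addr0 //.
  apply: nth_default; have : (size r < size conic)%N.
    by rewrite Pdiv.Ring.ltn_rmodp monic_neq0.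
  by rewrite sz_c ltnS => /leq_trans; apply.
have van_r x y : x ^+ 2 + y ^+ 2 = 1 -> (r`_1).[x] * y + (r`_0).[x] = 0.
  move=> xy; have cxy : beval idfun x y conic = 0 by rewrite beval_conic xy subrr.
  have := van_a _ _ cxy; rewrite {1}aE -/r rmorphD rmorphM /= cxy mulr0 add0r.
  by rewrite {1}rE rmorphD rmorphM /= !bevalC bevalX !map_poly_id.
have split_r x : (r`_0).[x] = 0 /\ (r`_1 * ('X^2 - 1)).[x] = 0.
  have [y y2] := closed_pth_root (1 - x ^+ 2) (isT : (0 < 2)%N).
  have e1 : (r`_1).[x] * y + (r`_0).[x] = 0 by apply: van_r; rewrite -y2; ring.
  have e2 : (r`_1).[x] * - y + (r`_0).[x] = 0.
    by apply: van_r; rewrite sqrrN -y2; ring.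
  have r0 : (r`_0).[x] = 0.
    apply: (mulfI two_neq0); rewrite mulr0 -[RHS]addr0 -{1}e1 -e2; ring.
  split=> //; move: e1; rewrite r0 addr0 => /eqP; rewrite mulf_eq0.
  rewrite hornerM => /orP[/eqP->|/eqP y0]; first by rewrite mul0r.
  have -> : ('X^2 - 1).[x] = - y ^+ 2.
    by rewrite -y2 hornerD hornerN hornerXn hornerC; ring.
  by rewrite y0 expr0n oppr0 mulr0.
have r0 : r`_0 = 0 by apply: poly_vanishing_everywhere => x; apply/eqP; case: (split_r x).
have /eqP : r`_1 * ('X^2 - 1) = 0.
  by apply: poly_vanishing_everywhere => x; apply/eqP; case: (split_r x).
rewrite mulf_eq0 -[X in 'X^2 - X]polyC1 => /orP[/eqP r1|]; last first.
  by rewrite -size_poly_eq0 size_XnsubC.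
by rewrite rE r0 r1 mul0r add0r.
Qed.

End Conic.

Section Component.
Context (k : closedFieldType) (hk : 2%N \notin [pchar k]).
Context (f : {poly {poly k}}) (rad_f : defines_radical f).

Definition vanishes (W : {mpoly k[4]}) : Prop :=
  forall x0 x1 q0 q1 : k, beval idfun x0 x1 f = 0 -> q0 ^+ 2 + q1 ^+ 2 = 1 ->
    mmap idfun (vec4 x0 x1 q0 q1) W = 0.

Definition sliceX (q0 q1 : k) : {mpoly k[4]} -> {poly {poly k}} :=
  mmap (@polyCC k) (vec4 'X%:P 'X q0%:P%:P q1%:P%:P).
Definition sliceQ (x0 x1 : k) : {mpoly k[4]} -> {poly {poly k}} :=
  mmap (@polyCC k) (vec4 x0%:P%:P x1%:P%:P 'X%:P 'X).

Lemma beval_polyCC (K : comNzRingType) (emb : {rmorphism k -> K}) x y c :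
  beval emb x y c%:P%:P = emb c.
Proof. by rewrite bevalC map_polyC hornerC. Qed.

Lemma beval_polyCX (K : comNzRingType) (emb : {rmorphism k -> K}) x y :
  beval emb x y 'X%:P = x.
Proof. by rewrite bevalC map_polyX hornerX. Qed.

Lemma beval_sliceX (K : comNzRingType) (emb : {rmorphism k -> K}) x y q0 q1 W :
  beval emb x y (sliceX q0 q1 W) = mmap emb (vec4 x y (emb q0) (emb q1)) W.
Proof.
rewrite /sliceX beval_mmap; apply: eq_mmap => // i /=.
case: i => [[|[|[|[|//]]]] lti]; rewrite /vec4 !(tnth_nth 0) /=;
  by rewrite ?beval_polyCC ?beval_polyCX ?bevalX.
Qed.

Lemma beval_sliceQ (K : comNzRingType) (emb : {rmorphism k -> K}) x0 x1 x y W :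
  beval emb x y (sliceQ x0 x1 W) = mmap emb (vec4 (emb x0) (emb x1) x y) W.
Proof.
rewrite /sliceQ beval_mmap; apply: eq_mmap => // i /=.
case: i => [[|[|[|[|//]]]] lti]; rewrite /vec4 !(tnth_nth 0) /=;
  by rewrite ?beval_polyCC ?beval_polyCX ?bevalX.
Qed.

Lemma vec4E (T : Type) (a b c d : T) :
  ((vec4 a b c d 0 = a) * (vec4 a b c d 1 = b) *
   (vec4 a b c d (inord 2) = c) * (vec4 a b c d (inord 3) = d))%type.
Proof. by rewrite /vec4 !(tnth_nth a) /= !inordK. Qed.

Lemma sum_delta (R : nzRingType) (n : nat) (E e : 'I_n -> R) (i : 'I_n) :
  (forall j, e j = (j == i)%:R) -> \sum_j E j * e j = E i.
Proof.
move=> eE; rewrite (bigD1 i) //= eE eqxx mulr1 big1 ?addr0 // => j /negPf ne_ji.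
by rewrite eE ne_ji mulr0.
Qed.

Lemma map_deriv_inner (p : {poly k}) : map_poly deriv p%:P = p^`()%:P.
Proof. by rewrite map_polyC. Qed.

Lemma map_deriv_sliceX q0 q1 G :
  map_poly deriv (sliceX q0 q1 G) = sliceX q0 q1 G^`M(0).
Proof.
rewrite /sliceX map_deriv_mmap (sum_delta _ (i := 0)) // => j.
rewrite -val_eqE /=.
case: j => [[|[|[|[|//]]]] ltj]; rewrite /vec4 (tnth_nth 0) /=;
  by rewrite ?map_derivX // map_deriv_inner ?derivX ?derivC.
Qed.

Lemma deriv_sliceX q0 q1 G : (sliceX q0 q1 G)^`() = sliceX q0 q1 G^`M(1).
Proof.
rewrite /sliceX deriv_mmap (sum_delta _ (i := 1)) // => j.
rewrite -val_eqE /=.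
case: j => [[|[|[|[|//]]]] ltj]; rewrite /vec4 (tnth_nth 0) /=;
  by rewrite ?derivX ?derivC.
Qed.

Lemma map_deriv_sliceQ x0 x1 G :
  map_poly deriv (sliceQ x0 x1 G) = sliceQ x0 x1 G^`M(inord 2).
Proof.
rewrite /sliceQ map_deriv_mmap (sum_delta _ (i := inord 2)) // => j.
rewrite -val_eqE /= inordK //.
case: j => [[|[|[|[|//]]]] ltj]; rewrite /vec4 (tnth_nth 0) /=;
  by rewrite ?map_derivX // map_deriv_inner ?derivX ?derivC.
Qed.

Lemma deriv_sliceQ x0 x1 G :
  (sliceQ x0 x1 G)^`() = sliceQ x0 x1 G^`M(inord 3).
Proof.
rewrite /sliceQ deriv_mmap (sum_delta _ (i := inord 3)) // => j.
rewrite -val_eqE /= inordK //.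
case: j => [[|[|[|[|//]]]] ltj]; rewrite /vec4 (tnth_nth 0) /=;
  by rewrite ?derivX ?derivC.
Qed.

(** The two factors are treated in turn. With q fixed over K, [extend_scalars] reduces the claim to
    k-points of the curve, and over each of them W restricts to a multiple of the conic. *)
Lemma product_nullstellensatz (K : fieldType) (emb : {rmorphism k -> K})
    (x0 x1 q0 q1 : K) W :
    beval emb x0 x1 f = 0 -> q0 ^+ 2 + q1 ^+ 2 = 1 -> vanishes W ->
  mmap emb (vec4 x0 x1 q0 q1) W = 0.
Proof.
move=> fx cq van.
pose s := [seq ((W@_m)%:P%:P * ('X%:P ^+ m 0%R * 'X ^+ m 1%R) : {poly {poly k}},
                q0 ^+ m (inord 2) * q1 ^+ m (inord 3)) | m <- msupp W].
have sE (z0 z1 : K) :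
    \sum_(u <- s) beval emb z0 z1 u.1 * u.2 = mmap emb (vec4 z0 z1 q0 q1) W.
  rewrite big_map; apply: eq_bigr => m _ /=.
  rewrite !(rmorphM, rmorphXn) /= beval_polyCC beval_polyCX bevalX -mulrA.
  congr (_ * _); rewrite /mmap1 !big_ord_recl big_ord0 mulr1 !mulrA.
  by congr (_ ^+ m _ * _ ^+ m _ * _ ^+ m _ * _ ^+ m _);
    apply: val_inj; rewrite /= ?inordK.
rewrite -sE; pose I := {P : k * k | beval idfun P.1 P.2 f == 0}.
apply: (@extend_scalars _ _ emb _ (@polyCC k) I
          (fun P => beval idfun (sval P).1 (sval P).2)) => /=.
- by move=> P c; rewrite beval_polyCC.
- by move=> c; rewrite beval_polyCC.
- move=> a van_a; have [x y fxy|g ->] := rad_f (a := a).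
    by apply: (van_a (exist _ (x, y) _)); rewrite /= fxy.
  by rewrite rmorphM /= fx mul0r.
case=> [[x y] /= /eqP fxy].
have embE u : emb (beval idfun x y u) = beval emb (emb x) (emb y) u.
  rewrite beval_idfun /beval /= /horner_eval -horner_map -map_poly_comp /=.
  by congr (_.[_]); apply: eq_map_poly => p /=; rewrite /horner_eval horner_map.
under eq_bigr do rewrite embE.
rewrite sE -beval_sliceQ.
have [u v|g ->] := conic_radical hk (a := sliceQ x y W).
  rewrite beval_conic beval_sliceQ => /eqP; rewrite subr_eq0 => /eqP cuv.
  exact: van.
by rewrite rmorphM /= beval_conic cq subrr mul0r.
Qed.

Lemma vanishes_derivX (G Fx Fy : {mpoly k[4]}) :
    (forall x0 x1 q0 q1, mmap idfun (vec4 x0 x1 q0 q1) Fx =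
                         beval idfun x0 x1 (map_poly deriv f)) ->
    (forall x0 x1 q0 q1, mmap idfun (vec4 x0 x1 q0 q1) Fy =
                         beval idfun x0 x1 f^`()) ->
  vanishes G -> vanishes (Fy * G^`M(0) - Fx * G^`M(1)).
Proof.
move=> FxE FyE vanG x0 x1 q0 q1 fx cq.
rewrite rmorphB !rmorphM /= FxE FyE.
have := tangent_derivative rad_f (a := sliceX q0 q1 G) _ fx.
rewrite map_deriv_sliceX deriv_sliceX !beval_sliceX => -> //; first by rewrite subrr.
by move=> x y fxy; rewrite beval_sliceX; apply: vanG.
Qed.

Lemma vanishes_derivQ (G : {mpoly k[4]}) : vanishes G ->
  vanishes ('X_(inord 3) * G^`M(inord 2) - 'X_(inord 2) * G^`M(inord 3)).
Proof.
move=> vanG x0 x1 q0 q1 fx cq.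
rewrite rmorphB !rmorphM /= !mmapX !mmap1U !vec4E.
have cq' : beval idfun q0 q1 (conic k) = 0 by rewrite beval_conic cq subrr.
have := tangent_derivative (conic_radical hk) (a := sliceQ x0 x1 G) _ cq'.
rewrite map_deriv_sliceQ deriv_sliceQ !beval_sliceQ => eq_d.
apply: (mulfI (two_neq0 hk)); rewrite mulr0 mulrBr !mulrA.
rewrite -(beval_conic_deriv1 q0 q1) -(beval_conic_deriv0 q0 q1) eq_d ?subrr //.
by move=> x y; rewrite beval_conic beval_sliceQ => /eqP; rewrite subr_eq0;
  move=> /eqP; apply: vanG.
Qed.

End Component.

(** The quotient rule dictates D on every fraction in the generators. Two fractions for the same
    element differ by a polynomial relation, which the hypothesis says is respected. *)
Lemma extend_derivation (k K : fieldType) (emb : {rmorphism k -> K}) (n : nat)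
    (v w : 'I_n -> K) :
    (forall z, in_adjoin emb v z) ->
    (forall G, mmap emb v G = 0 -> \sum_i mmap emb v G^`M(i) * w i = 0) ->
  exists D : K -> K,
    [/\ forall a b, D (a + b) = D a + D b,
        forall a b, D (a * b) = a * D b + b * D a,
        forall c, D (emb c) = 0 & forall i, D (v i) = w i].
Proof.
move=> gen compat; pose ev := mmap emb v.
pose del G := \sum_i ev G^`M(i) * w i.
have delD P Q : del (P + Q) = del P + del Q.
  rewrite -big_split; apply: eq_bigr => i _.
  by rewrite mderivD [ev _]rmorphD mulrDl.
have delN P : del (- P) = - del P.
  rewrite -sumrN; apply: eq_bigr => i _.
  by rewrite mderivN [ev _]rmorphN mulNr.
have delM P Q : del (P * Q) = ev P * del Q + ev Q * del P.
  rewrite /del !mulr_sumr -big_split; apply: eq_bigr => i _ /=.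
  by rewrite mderivM /ev rmorphD !rmorphM /=; ring.
have delC c : del c%:MP = 0.
  by apply: big1 => i _; rewrite mderivC /ev mmap0 mul0r.
have delX i : del 'X_i = w i.
  rewrite /del (bigD1 i) //= big1 => [|j /negPf ne_ji].
    by rewrite addr0 mderiv_var eqxx /ev rmorph1 mul1r.
  by rewrite mderiv_var eq_sym ne_ji /ev mmap0 mul0r.
have genb z : exists PR : {mpoly k[n]} * {mpoly k[n]},
    (ev PR.2 != 0) && (z == ev PR.1 / ev PR.2).
  by have [P [R [nz_R ->]]] := gen z; exists (P, R); rewrite nz_R eqxx.
pose D z := let PR := xchoose (genb z) in (del PR.1 - z * del PR.2) / ev PR.2.
have DE P R z : ev R != 0 -> z = ev P / ev R -> D z = (del P - z * del R) / ev R.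
  move=> nz_R zE; rewrite /D; have /andP[] := xchooseP (genb z).
  case: (xchoose _) => P' R' /= nz_R' /eqP zE'.
  have PE : ev P = z * ev R by rewrite zE divfK.
  have PE' : ev P' = z * ev R' by rewrite zE' divfK.
  have : del (P * R' - P' * R) = 0.
    apply: compat; rewrite -/ev /ev rmorphB !rmorphM /= -!/(ev _) PE PE'.
    by rewrite mulrAC subrr.
  rewrite delD delN !delM PE PE' => e0.
  apply/eqP; rewrite eqr_div // -subr_eq0 -oppr_eq0 -[X in _ == X]e0.
  apply/eqP; ring.
have rep z : exists P R, ev R != 0 /\ z = ev P / ev R by apply: gen.
exists D; split=> [a b|a b|c|i].
- have [P [R [nzR aE]]] := rep a; have [P' [R' [nzR' bE]]] := rep b.
  rewrite (DE P R a nzR aE) (DE P' R' b nzR' bE).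
  rewrite (DE (P * R' + P' * R) (R * R')).
  + by rewrite delD !delM {1}aE {1}bE aE bE /ev !rmorphM /=; field; apply/andP.
  + by rewrite /ev rmorphM mulf_neq0.
  + by rewrite aE bE /ev rmorphD !rmorphM /=; field; apply/andP.
- have [P [R [nzR aE]]] := rep a; have [P' [R' [nzR' bE]]] := rep b.
  rewrite (DE P R a nzR aE) (DE P' R' b nzR' bE) (DE (P * P') (R * R')).
  + by rewrite !delM aE bE /ev !rmorphM /=; field; apply/andP.
  + by rewrite /ev rmorphM mulf_neq0.
  + by rewrite aE bE /ev !rmorphM /=; field; apply/andP.
- rewrite (DE c%:MP 1); rewrite ?[ev 1]rmorph1 ?oner_eq0 //.
    by rewrite delC -[1]mpolyC1 delC mulr0 subrr mul0r.
  by rewrite divr1 /ev mmapC.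
rewrite (DE 'X_i 1); rewrite ?[ev 1]rmorph1 ?oner_eq0 //.
  by rewrite delX -[1]mpolyC1 delC mulr0 subr0 divr1.
by rewrite divr1 /ev mmapX mmap1U.
Qed.

Lemma det3_direction (K : fieldType) (x0 x1 x0' x1' w0 w1 : K) :
  det3 (vec3 x0 x1 1) (vec3 x0' x1' 1) (vec3 w0 w1 0) =
  (x0 - x0') * - w1 - (x1 - x1') * - w0.
Proof.
rewrite /det3 (expand_det_row _ ord0) !big_ord_recl big_ord0 /cofactor.
rewrite !(expand_det_row _ ord0) !big_ord_recl !big_ord0 /cofactor !det_mx11.
rewrite !mxE /= /bump /= /vec3 /tnth /=.
by ring.
Qed.

(** * Invariance *)

Section Biderivation.
Context (k K : fieldType) (emb : {rmorphism k -> K}) (M : lmodType K).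
Context (b : K -> K -> M) (hb : alternating_biderivation emb b).

Lemma abd_anti g h : b g h = - b h g.
Proof.
apply/eqP; rewrite -addr_eq0; have := abd_alt hb (g + h).
rewrite (abd_addl hb) !(abd_addr hb) !(abd_alt hb) add0r addr0 => ->.
exact: eqxx.
Qed.

Lemma abd_subl g g' h : b (g - g') h = b g h - b g' h.
Proof. by apply/eqP; rewrite -subr_eq0 opprB addrA -(abd_addl hb) subrK subrr. Qed.

Lemma abd_subr g h h' : b g (h - h') = b g h - b g h'.
Proof. by rewrite abd_anti abd_subl opprB addrC -abd_anti -[- b h g]abd_anti. Qed.

Lemma abd_onel h : b 1 h = 0.
Proof. by rewrite -(rmorph1 emb) (abd_constl hb). Qed.

Lemma abd_oner g : b g 1 = 0.
Proof. by rewrite -(rmorph1 emb) (abd_constr hb). Qed.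

Lemma abd_mmapl n (v : 'I_n -> K) p h :
  b (mmap emb v p) h = \sum_i mmap emb v p^`M(i) *: b (v i) h.
Proof.
apply: (@mmap_chain_rule _ _ _ M emb v (b^~ h)) => [g g'|g g'|c].
- exact: abd_addl hb _ _ _.
- exact: abd_mull hb _ _ _.
- exact: abd_constl hb _ _.
Qed.

(* The chord x - x' is a multiple of q, and q is orthogonal to dq.             *)
Lemma secant_biderivation (x0 x1 x0' x1' q0 q1 : K) : 2 != 0 :> K ->
    q0 ^+ 2 + q1 ^+ 2 = 1 -> (x0 - x0') * q1 = (x1 - x1') * q0 ->
  b x0 q0 + b x1 q1 = b x0' q0 + b x1' q1.
Proof.
move=> nz2 cq eq_d; pose l := (x0 - x0') * q0 + (x1 - x1') * q1.
have d0 : x0 - x0' = l * q0.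
  transitivity ((x0 - x0') * q0 ^+ 2 + (x1 - x1') * q0 * q1); last by rewrite /l; ring.
  by rewrite -eq_d -mulrA -expr2 -mulrDr cq mulr1.
have d1 : x1 - x1' = l * q1.
  transitivity ((x1 - x1') * q1 ^+ 2 + (x0 - x0') * q1 * q0); last by rewrite /l; ring.
  by rewrite eq_d -mulrA -expr2 -mulrDr [q1 ^+ 2 + _]addrC cq mulr1.
apply/eqP; rewrite -subr_eq0 opprD addrACA -!abd_subl d0 d1.
rewrite !(abd_mull hb) !(abd_alt hb) !scaler0 !add0r.
(* Expanding b(l, q_0^2 + q_1^2) = b(l, 1) = 0 gives twice the expression left to kill. *)
have := abd_oner l; rewrite -cq !expr2 (abd_addr hb) !(abd_mulr hb) => e0.
rewrite -(inj_eq (scalerI nz2)) scaler0 -[2%:R]/(1 + 1) scalerDl !scale1r.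
by rewrite addrACA e0.
Qed.

(** The normal (n0, n1) being nonzero, n . dx = 0 forces dx_0 /\ dx_1 = 0. As the dn_i are
    combinations of dx_0 and dx_1, they too are killed by wedging with dx_j, and q - q' = l n leaves
    only the term (n . dx) /\ dl. *)
Lemma normal_biderivation (x0 x1 n0 n1 q0 q1 q0' q1' : K) :
    (n0 != 0) || (n1 != 0) ->
    (forall h, n0 *: b x0 h + n1 *: b x1 h = 0) ->
    (forall h, exists c0 c1, b n0 h = c0 *: b x0 h + c1 *: b x1 h) ->
    (forall h, exists c0 c1, b n1 h = c0 *: b x0 h + c1 *: b x1 h) ->
    (q0 - q0') * n1 = (q1 - q1') * n0 ->
  b x0 q0 + b x1 q1 = b x0 q0' + b x1 q1'.
Proof.
move=> nz_n tan dn0 dn1 eq_d.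
have x01 : b x0 x1 = 0.
  have := tan x1; rewrite (abd_alt hb) scaler0 addr0 => /eqP.
  have := tan x0; rewrite (abd_alt hb) scaler0 add0r abd_anti scalerN => /eqP.
  rewrite oppr_eq0 !scaler_eq0; case/orP: nz_n => /negPf-> /=.
    by move=> _ /eqP.
  by move/eqP.
have x0n n : (forall h, exists c0 c1, b n h = c0 *: b x0 h + c1 *: b x1 h) ->
    b x0 n = 0 /\ b x1 n = 0.
  move=> dn; split; rewrite abd_anti.
    have [c0 [c1 ->]] := dn x0.
    by rewrite (abd_alt hb) abd_anti x01 oppr0 !scaler0 addr0 oppr0.
  have [c0 [c1 ->]] := dn x1.
  by rewrite (abd_alt hb) x01 !scaler0 addr0 oppr0.
have [[x0n0 x1n0] [x0n1 x1n1]] := (x0n _ dn0, x0n _ dn1).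
have [l [d0 d1]] : exists l, q0 - q0' = l * n0 /\ q1 - q1' = l * n1.
  case/orP: nz_n => nz.
    exists ((q0 - q0') / n0); rewrite divfK //; split=> //.
    by rewrite mulrAC eq_d mulfK.
  exists ((q1 - q1') / n1); rewrite divfK //; split=> //.
  by rewrite mulrAC -eq_d mulfK.
apply/eqP; rewrite -subr_eq0 opprD addrACA -!abd_subr d0 d1.
rewrite !(abd_mulr hb) x0n0 x1n1 !scaler0 !add0r.
by rewrite tan.
Qed.

End Biderivation.

(** * The gradient and [omega] at K-points of C x D *)

Section Points.
Context (k : closedFieldType) (hk : 2%N \notin [pchar k]) (m : nat).
Context (F : 'I_m -> {mpoly k[3]}).
Hypothesis irrF : forall i, irreducible_form (F i).

Definition grad (K : fieldType) (emb : {rmorphism k -> K}) (y : point m K)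
  (j : 'I_3) : K := mmap emb (hcoordX y) (F (idx y))^`M(j).

Definition lift_mpoly : {mpoly k[3]} -> {mpoly k[4]} :=
  mmap (@mpolyC 4 k) (vec3 'X_0 'X_1 1).
HB.instance Definition _ := GRing.RMorphism.on lift_mpoly.

Lemma mmap_lift (K : comNzRingType) (emb : {rmorphism k -> K}) x0 x1 q0 q1 p :
  mmap emb (vec4 x0 x1 q0 q1) (lift_mpoly p) = mmap emb (vec3 x0 x1 1) p.
Proof.
apply: (eq_mpoly_rmorphism
          (phi := mmap emb (vec4 x0 x1 q0 q1) \o lift_mpoly)) => [c|i] /=.
  by rewrite /lift_mpoly !mmapC.
rewrite /lift_mpoly !mmapX !mmap1U.
case: i => [[|[|[|//]]] lti]; rewrite /vec3 !(tnth_nth 0) /=.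
- by rewrite mmapX mmap1U vec4E.
- by rewrite mmapX mmap1U vec4E.
- by rewrite rmorph1.
Qed.

Lemma on_Y_affine (K : fieldType) (emb : {rmorphism k -> K}) (y : point m K) :
  on_Y F emb y -> beval emb (px0 y) (px1 y) (affine (F (idx y))) = 0.
Proof. by case=> Fy _; rewrite beval_affine. Qed.

Lemma component_irreducible (K : fieldType) (emb : {rmorphism k -> K})
    (y : point m K) : on_Y F emb y -> irreducible_elt (affine (F (idx y))).
Proof.
move=> /on_Y_affine fy; apply: affine_irreducible => //; apply/negP => Uf.
have := congr1 (beval emb (px0 y) (px1 y)) (divrr Uf).
by rewrite rmorphM rmorph1 /= fy mul0r => /esym/eqP; rewrite oner_eq0.
Qed.

Lemma dominates_vanishes (K : fieldType) (emb : {rmorphism k -> K})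
    (y : point m K) G : dominates F emb y ->
  mmap emb (coords y) G = 0 -> vanishes (affine (F (idx y))) G.
Proof.
move=> [_ dom] /dom van x0 x1 q0 q1 fx cq.
apply: (van (Point (idx y) x0 x1 q0 q1)) => //; split=> //=.
by rewrite -beval_affine.
Qed.

(** If n . q vanished at a dominant point it would vanish on the whole component. Taking q = (1, 0)
    and q = (0, 1) on the conic, every point of the curve would be singular. *)
Lemma grad_not_tangent (K : fieldType) (emb : {rmorphism k -> K})
    (y : point m K) : dominates F emb y ->
  grad emb y 0 * pq0 y + grad emb y 1 * pq1 y != 0.
Proof.
move=> dom; apply/negP => /eqP g0; set f := F (idx y).
pose G := lift_mpoly f^`M(0) * 'X_(inord 2) + lift_mpoly f^`M(1) * 'X_(inord 3).
have /(dominates_vanishes dom) vanG : mmap emb (coords y) G = 0.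
  rewrite -[RHS]g0 rmorphD !rmorphM /= !mmap_lift !mmapX !mmap1U.
  by rewrite /coords !vec4E.
apply: (has_smooth_point (component_irreducible (proj1 dom))) => x0 x1 fx.
rewrite affine_deriv0 affine_deriv1 !beval_affine.
split.
  have /(vanG x0 x1 1 0 fx) : 1 ^+ 2 + 0 ^+ 2 = 1 :> k.
    by rewrite expr1n expr0n addr0.
  rewrite rmorphD !rmorphM /= !mmap_lift !mmapX !mmap1U !vec4E.
  by rewrite mulr1 mulr0 addr0.
have /(vanG x0 x1 0 1 fx) : 0 ^+ 2 + 1 ^+ 2 = 1 :> k.
  by rewrite expr1n expr0n add0r.
rewrite rmorphD !rmorphM /= !mmap_lift !mmapX !mmap1U !vec4E.
by rewrite mulr1 mulr0 add0r.
Qed.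

Lemma grad_neq0 (K : fieldType) (emb : {rmorphism k -> K}) (y : point m K) :
  dominates F emb y -> (grad emb y 0 != 0) || (grad emb y 1 != 0).
Proof.
move/grad_not_tangent; apply: contraR; rewrite negb_or !negbK.
by move=> /andP[/eqP-> /eqP->]; rewrite !mul0r addr0.
Qed.

Lemma omega_pullback (K : fieldType) (emb : {rmorphism k -> K}) (y : point m K)
    (M : lmodType K) (b : K -> K -> M) :
  \sum_(u <- pullback emb y (@restrict_Y k m (omega k))) u.1.1 *: b u.1.2 u.2 =
  b (px0 y) (pq0 y) + b (px1 y) (pq1 y).
Proof.
rewrite /pullback /restrict_Y /omega /= !big_cons big_nil addr0 /=.
rewrite /ratfun_at /= !rmorph1 !divr1 !scale1r !mmapX !mmap1U.
by rewrite /coords /vec4 !(tnth_nth (px0 y)).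
Qed.

Lemma omega_secant (K : fieldType) (emb : {rmorphism k -> K})
    (M : lmodType K) (b : K -> K -> M) (x0 x1 x0' x1' q0 q1 : K) :
    alternating_biderivation emb b -> q0 ^+ 2 + q1 ^+ 2 = 1 ->
    det3 (vec3 x0 x1 1) (vec3 x0' x1' 1) (vec3 q0 q1 0) = 0 ->
  b x0 q0 + b x1 q1 = b x0' q0 + b x1' q1.
Proof.
move=> hb cq; rewrite det3_direction => /eqP; rewrite subr_eq0 !mulrN eqr_opp.
move=> /eqP eq_d; apply: (secant_biderivation hb) => //.
by rewrite -(rmorph_nat emb) fmorph_eq0 two_neq0.
Qed.

(** The gradient is assumed nonzero instead of the point dominant, so that the lemma applies to the
    middle point of a billiards path. *)
Lemma omega_reflection (K : fieldType) (emb : {rmorphism k -> K})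
    (M : lmodType K) (b : K -> K -> M) (y : point m K) (q0' q1' : K) :
    alternating_biderivation emb b -> mmap emb (hcoordX y) (F (idx y)) = 0 ->
    (grad emb y 0 != 0) || (grad emb y 1 != 0) ->
    det3 (hcoordQ y) (vec3 q0' q1' 1) (vec3 (grad emb y 0) (grad emb y 1) 0) = 0 ->
  b (px0 y) (pq0 y) + b (px1 y) (pq1 y) = b (px0 y) q0' + b (px1 y) q1'.
Proof.
move=> hb Fy nz_n; rewrite det3_direction => /eqP.
rewrite subr_eq0 !mulrN eqr_opp => /eqP eq_d.
have chain p h : b (mmap emb (hcoordX y) p) h =
    mmap emb (hcoordX y) p^`M(0) *: b (px0 y) h +
    mmap emb (hcoordX y) p^`M(1) *: b (px1 y) h.
  rewrite (abd_mmapl hb) !big_ord_recl big_ord0 addr0.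
  rewrite /hcoordX /vec3 !(tnth_nth 0) /= (abd_onel hb) scaler0 addr0.
  by congr (mmap _ _ _^`M(_) *: _ + mmap _ _ _^`M(_) *: _); apply: val_inj.
apply: (normal_biderivation hb nz_n) eq_d => h.
- by rewrite -chain Fy -(rmorph0 emb) (abd_constl hb).
- by do 2!eexists; apply: chain.
- by do 2!eexists; apply: chain.
Qed.

Lemma normal_slope_grad (K : fieldType) (emb : {rmorphism k -> K}) (y : point m K) :
  let n := normal_slope F emb y in n 0 = grad emb y 0 /\ n 1 = grad emb y 1.
Proof.
by rewrite /normal_slope /tangent_slope /slope /vec2 !(tnth_nth 0) /= opprK.
Qed.

End Points.

(** * Nonvanishing of [omega] and invariance under the three correspondences *)

Section Invariance.
Context (k : closedFieldType) (hk : 2%N \notin [pchar k]) (m : nat).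
Context (F : 'I_m -> {mpoly k[3]}).
Hypothesis irrF : forall i, irreducible_form (F i).

Lemma wedge_biderivation (K : fieldType) (emb : {rmorphism k -> K})
    (D1 D2 : K -> K) :
    (forall a b, D1 (a + b) = D1 a + D1 b) ->
    (forall a b, D1 (a * b) = a * D1 b + b * D1 a) ->
    (forall c, D1 (emb c) = 0) ->
    (forall a b, D2 (a + b) = D2 a + D2 b) ->
    (forall a b, D2 (a * b) = a * D2 b + b * D2 a) ->
    (forall c, D2 (emb c) = 0) ->
  alternating_biderivation emb
    (fun g h => D1 g * D2 h - D2 g * D1 h : K^o).
Proof.
move=> D1D D1M D1C D2D D2M D2C.
split=> [g g' h|g h h'|g g' h|g h h'|c h|c g|g].
- by rewrite D1D D2D !mulrDl opprD addrACA.
- by rewrite D1D D2D !mulrDr opprD addrACA.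
- by rewrite D1M D2M /GRing.scale /=; ring.
- by rewrite D1M D2M /GRing.scale /=; ring.
- by rewrite D1C D2C !mul0r subrr.
- by rewrite D1C D2C !mulr0 subrr.
- by rewrite mulrC subrr.
Qed.

(** T lifts the desired derivation to polynomials. A relation at the dominant point y vanishes on
    the component, hence so does its image under T, which therefore vanishes at y too. *)
Lemma dominates_derivation (K : fieldType) (emb : {rmorphism k -> K})
    (y : point m K) (w : 'I_4 -> K) (T : {mpoly k[4]} -> {mpoly k[4]}) :
    dominates F emb y -> (forall z, in_adjoin emb (coords y) z) ->
    (forall G, mmap emb (coords y) (T G) =
               \sum_i mmap emb (coords y) G^`M(i) * w i) ->
    (forall G, vanishes (affine (F (idx y))) G ->
               vanishes (affine (F (idx y))) (T G)) ->
  exists D : K -> K,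
    [/\ forall a b, D (a + b) = D a + D b,
        forall a b, D (a * b) = a * D b + b * D a,
        forall c, D (emb c) = 0 & forall i, D (coords y i) = w i].
Proof.
move=> dom gen TE Tvan; apply: extend_derivation => // G G0.
rewrite -TE; have [onY _] := dom.
apply: (product_nullstellensatz hk) (on_Y_affine onY) (proj2 onY) _.
  exact: plane_curve_nullstellensatz (component_irreducible irrF onY).
by apply: Tvan; apply: dominates_vanishes G0.
Qed.

Lemma sum4 (V : nmodType) (E : 'I_4 -> V) :
  \sum_i E i = E 0 + E 1 + E (inord 2) + E (inord 3).
Proof.
rewrite !big_ord_recl big_ord0 addr0 !addrA.
by congr (E _ + E _ + E _ + E _); apply: val_inj; rewrite /= ?inordK.
Qed.

Lemma omega_nonzero : nonzero_form F (@restrict_Y k m (omega k)).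
Proof.
move=> K emb y dom gen omega0.
have rad_f := plane_curve_nullstellensatz (component_irreducible irrF (proj1 dom)).
pose f := F (idx y).
pose T1 G := lift_mpoly f^`M(1) * G^`M(0) - lift_mpoly f^`M(0) * G^`M(1).
have [D1 [D1D D1M D1C D1X]] : exists D : K -> K,
    [/\ forall a b, D (a + b) = D a + D b,
        forall a b, D (a * b) = a * D b + b * D a,
        forall c, D (emb c) = 0 &
        forall i, D (coords y i) =
          vec4 (grad F emb y 1) (- grad F emb y 0) 0 0 i].
  apply: (dominates_derivation (T := T1)) => // G.
    rewrite sum4 !vec4E !mulr0 !addr0 rmorphB !rmorphM /= !mmap_lift.
    by rewrite mulrN [X in X - _]mulrC [X in _ - X]mulrC.
  apply: vanishes_derivX => // x0 x1 q0 q1.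
    by rewrite mmap_lift affine_deriv0 beval_affine.
  by rewrite mmap_lift affine_deriv1 beval_affine.
pose T2 (G : {mpoly k[4]}) :=
  'X_(inord 3) * G^`M(inord 2) - 'X_(inord 2) * G^`M(inord 3).
have [D2 [D2D D2M D2C D2X]] : exists D : K -> K,
    [/\ forall a b, D (a + b) = D a + D b,
        forall a b, D (a * b) = a * D b + b * D a,
        forall c, D (emb c) = 0 &
        forall i, D (coords y i) = vec4 0 0 (pq1 y) (- pq0 y) i].
  apply: (dominates_derivation (T := T2)) => // G.
    rewrite sum4 !vec4E !mulr0 !add0r rmorphB !rmorphM /= !mmapX !mmap1U.
    by rewrite /coords !vec4E mulrN [X in X - _]mulrC [X in _ - X]mulrC.
  exact: vanishes_derivQ.
have hb := wedge_biderivation D1D D1M D1C D2D D2M D2C.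
pose b := fun g h => D1 g * D2 h - D2 g * D1 h : K^o.
have := omega0 _ b hb; rewrite omega_pullback big_nil /b => /eqP; apply/negP.
have cE := (D1X 0, D1X 1, D1X (inord 2), D1X (inord 3),
            D2X 0, D2X 1, D2X (inord 2), D2X (inord 3)).
rewrite /coords !vec4E in cE; rewrite !cE !mul0r !subr0 mulrNN addrC.
exact: grad_not_tangent.
Qed.

Lemma secant_invariant :
  invariant_form (@secant k m F) (@restrict_Y k m (omega k)).
Proof.
move=> G [eq0 eq1 det0 _] M b hb; rewrite !omega_pullback -eq0 -eq1.
apply: (omega_secant hk hb) det0.
exact: (proj2 (proj1 (psrc_dominates G))).
Qed.

Lemma reflection_invariant :
  invariant_form (@reflection k m F) (@restrict_Y k m (omega k)).
Proof.
move=> G [_ eq0 eq1 det0 _] M b hb; rewrite !omega_pullback -eq0 -eq1.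
have [n0 n1] := normal_slope_grad F (pemb G) (psrc G).
apply: (omega_reflection hb (proj1 (proj1 (psrc_dominates G)))).
  exact/grad_neq0/psrc_dominates.
by rewrite -n0 -n1.
Qed.

Lemma rmorph_grad (K L : fieldType) (embK : {rmorphism k -> K})
    (embL : {rmorphism k -> L}) (phi : {rmorphism K -> L}) (y : point m K) j :
  phi \o embK =1 embL -> phi (grad F embK y j) = grad F embL (map_point phi y) j.
Proof.
move=> phiE; rewrite /grad /mmap rmorph_sum; apply: eq_bigr => u _.
rewrite rmorphM /= -phiE; congr (_ * _); rewrite /mmap1 rmorph_prod.
apply: eq_bigr => i _; rewrite rmorphXn /=; congr (_ ^+ _).
rewrite /hcoordX /vec3 !(tnth_nth 0).
by case: i => [[|[|[|//]]] lti] //=; rewrite rmorph1.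
Qed.

Lemma rmorph_det3 (K L : fieldType) (phi : {rmorphism K -> L})
    (x0 x1 x0' x1' w0 w1 : K) :
  phi (det3 (vec3 x0 x1 1) (vec3 x0' x1' 1) (vec3 w0 w1 0)) =
  det3 (vec3 (phi x0) (phi x1) 1) (vec3 (phi x0') (phi x1') 1)
       (vec3 (phi w0) (phi w1) 0).
Proof. by rewrite !det3_direction !(rmorphB, rmorphM, rmorphN). Qed.

(* The intermediate point (c', q) of a path (c, q), (c', q), (c', q') is      *)
(* already defined over the function field of the composite, so no            *)
(* separability of M over that field is needed.                               *)
Lemma billiards_invariant :
  invariant_form (@billiards k m F) (@restrict_Y k m (omega k)).
Proof.
move=> G [A [B [[eqA0 eqA1 detA _] [idB eqB0 eqB1 detB _]]]].
move=> [M [emb [phi [alpha [beta [[phiE alphaE betaE] [srcE midE tgtE]]]]]]].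
move=> N b hb; rewrite !omega_pullback.
(* The middle point (c', q) takes c' from the target and q from the source. *)
pose mid := Point (idx (ptgt G)) (px0 (ptgt G)) (px1 (ptgt G))
                  (pq0 (psrc G)) (pq1 (psrc G)).
have [s0 s1 s2 s3] : [/\ phi (px0 (psrc G)) = alpha (px0 (psrc A)),
    phi (px1 (psrc G)) = alpha (px1 (psrc A)),
    phi (pq0 (psrc G)) = alpha (pq0 (psrc A)) &
    phi (pq1 (psrc G)) = alpha (pq1 (psrc A))] by case: srcE.
have [m0 m1 m2 m3] : [/\ alpha (px0 (ptgt A)) = beta (px0 (psrc B)),
    alpha (px1 (ptgt A)) = beta (px1 (psrc B)),
    alpha (pq0 (ptgt A)) = beta (pq0 (psrc B)) &
    alpha (pq1 (ptgt A)) = beta (pq1 (psrc B))] by case: midE.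
have [ti t0 t1 [t2 t3]] : [/\ idx (ptgt B) = idx (ptgt G),
    beta (px0 (ptgt B)) = phi (px0 (ptgt G)),
    beta (px1 (ptgt B)) = phi (px1 (ptgt G)) &
    beta (pq0 (ptgt B)) = phi (pq0 (ptgt G)) /\
    beta (pq1 (ptgt B)) = phi (pq1 (ptgt G))] by case: tgtE.
have mid_psrcB : map_point phi mid = map_point beta (psrc B).
  rewrite /map_point /= -ti -idB -t0 -t1 -eqB0 -eqB1 s2 s3 eqA0 eqA1 m2 m3.
  by [].
(* Over M the middle point is the source of the reflection component [B], where the gradient is
   known to be nonzero. Equations between elements of the function field of [G] may be checked in M
   because [phi] is injective. *)
have phi_grad j : phi (grad F (pemb G) mid j) = beta (grad F (pemb B) (psrc B) j).
  by rewrite (rmorph_grad _ _ phiE) (rmorph_grad _ _ betaE) mid_psrcB.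
transitivity (b (px0 mid) (pq0 mid) + b (px1 mid) (pq1 mid)).
  apply: (omega_secant hk hb); first exact: (proj2 (proj1 (psrc_dominates G))).
  apply: (fmorph_inj phi); rewrite rmorph0 rmorph_det3 s0 s1 s2 s3 /=.
  rewrite -t0 -t1 -eqB0 -eqB1 -m0 -m1 -rmorph_det3.
  by rewrite [det3 _ _ _]detA rmorph0.
apply: (omega_reflection hb (y := mid)).
- exact: (proj1 (proj1 (ptgt_dominates G))).
- rewrite -!(fmorph_eq0 phi) !phi_grad !fmorph_eq0.
  exact/grad_neq0/psrc_dominates.
have [n0 n1] := normal_slope_grad F (pemb B) (psrc B).
apply: (fmorph_inj phi); rewrite rmorph0 rmorph_det3 !phi_grad /=.
rewrite -t2 -t3 s2 s3 eqA0 eqA1 m2 m3 -rmorph_det3 -n0 -n1.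
by rewrite [det3 _ _ _]detB rmorph0.
Qed.

End Invariance.

Theorem theorem1p7 (k : closedFieldType) (hk : 2%N \notin [pchar k])
    (d m : nat) (hd : (2 <= d)%N)
    (F : 'I_m -> {mpoly k[3]}) (hF : billiard_curve d F) :
  [/\ invariant_form (@billiards k m F) (@restrict_Y k m (omega k)),
      invariant_form (@secant k m F) (@restrict_Y k m (omega k)),
      invariant_form (@reflection k m F) (@restrict_Y k m (omega k))
    & exists eta : form2_Y k m,
        nonzero_form F eta /\ invariant_form (@billiards k m F) eta].
Proof.
have irrF := bc_irreducible hF; have inv_b := billiards_invariant hk irrF.
split=> //; [exact: secant_invariant | exact: reflection_invariant |].
by exists (@restrict_Y k m (omega k)); split=> //; apply: omega_nonzero.
Qed.
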